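(* Assume $-y\ge r/(4c)$. Let $\alpha_{\beta_0}$ be the $\beta_0$-barrier strategy in the original game. For every $x\in[0,D]$ one has $$g(x)=J(x,\alpha_{\beta_0}):=\sup_{\psi\in\mathcal{P}^2,\,T\in[0,\infty)}c(x,T,\psi,\alpha_{\beta_0}[\psi]).$$
   Context: Fixed data: constants $D>0$, $r>0$, $c_1>0$, $c_2>0$, $y\in\mathbb{R}$; $c:=(c_1^{-1}+c_2^{-1})^{-1}$; and a continuous, strictly increasing function $h:[0,D]\to[0,\infty)$ with $h(0)=0$. Let $\mathcal{P}$ be the set of continuous functions $[0,\infty)\to\mathbb{R}$ starting at $0$, and $\mathcal{E}$ the set of nondecreasing right-continuous functions with left limits $[0,\infty)\to[0,\infty)$ (a positive value at time $0$ is allowed and is regarded as a jump at time $0$). For $T\ge0$ and $\psi=(\psi^1,\psi^2)\in\mathcal{P}^2$ let $\mathbb{I}(T,\psi)=\int_0^T\big[c_1(\dot\psi^1(s))^2+c_2(\dot\psi^2(s))^2\big]ds$ if $\psi^1,\psi^2$ are absolutely continuous on $[0,T]$, and $\mathbb{I}(T,\psi)=+\infty$ otherwise. Original game. Given $x\in[0,D]$, $\psi\in\mathcal{P}^2$, $(\zeta,\varrho)\in\mathcal{E}^2$, the dynamics are $\varphi(t)=x+yt+\psi^1(t)-\psi^2(t)+\zeta(t)-\varrho(t)$, $t\ge0$. The minimizing player uses causal strategies $\alpha:\mathcal{P}^2\to\mathcal{E}^2$, $\alpha[\psi]=(\zeta,\varrho)$, keeping $\varphi(t)\in[0,D]$ for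 all $t\ge 0$. The cost is $$c(x,T,\psi,\zeta,\varrho)=\int_0^Th(\varphi(t))\,dt+r\varrho(T)-\mathbb{I}(T,\psi).$$ Skorohod map. For $a<b$, $\Gamma_{[a,b]}$ maps a right-continuous path with left limits $\omega:[0,\infty)\to\mathbb{R}$ to the unique triplet $(\varphi,\eta_1,\eta_2)$ such that $\varphi=\omega+\eta_1-\eta_2$, $\varphi(t)\in[a,b]$ for all $t$, $\eta_1,\eta_2$ are nonnegative and nondecreasing with $\eta_i(0-)=0$ (a positive value $\eta_i(0)$ is regarded as a jump at $0$), and $\int_{[0,\infty)}1_{(a,b]}(\varphi)\,d\eta_1=\int_{[0,\infty)}1_{[a,b)}(\varphi)\,d\eta_2=0$. Barrier strategy. For $\beta\in(0,D]$ and initial state $x$, the $\beta$-barrier strategy $\alpha_\beta=(\alpha_{\beta,1},\alpha_{\beta,2})$ is given by $(\varphi,\alpha_{\beta,1}[\psi],\alpha_{\beta,2}[\psi])=\Gamma_{[0,\beta]}(x+y\cdot+\psi^1-\psi^2)$ for every $\psi\in\mathcal{P}^2$. For $\beta=0$ it keeps the dynamics at $0$: for $\psi$ absolutely continuous on $[0,T]$, $\zeta(t)=\int_0^t(\dot\psi^1-\dot\psi^2+y)^-ds$ and $\varrho(t)=x+\int_0^t(\dot\psi^1-\dot\psi^2+y)^+ds$ on $[0,T]$; pairs $(\psi,T)$ with $\mathbb{I}(T,\psi)=+\infty$ are assigned cost $-\infty$. The function $g$. Under $-y\ge r/(4c)$ define $$\beta_0=\begin{cases}h^{-1}\big(-\tfrac{r^2}{4c}-ry\big),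 & -h(D)\le \tfrac{r^2}{4c}+ry\le 0,\\ D, & \tfrac{r^2}{4c}+ry<-h(D),\end{cases}$$ and $g:[0,D]\to\mathbb{R}$ by $$g(x)=\int_0^x2c\Big(-y-\sqrt{y^2-h(u)/c}\Big)du\ \ (0\le x\le\beta_0),\qquad g(x)=g(\beta_0)+r(x-\beta_0)\ \ (\beta_0<x\le D).$$ (One has $y^2-h(u)/c\ge0$ for $u\in[0,\beta_0]$.) *)

(* Defs.v *)
From HB Require Import structures.
From mathcomp Require Import all_boot all_order all_algebra.
From mathcomp Require Import all_classical all_reals all_analysis.

Set Implicit Arguments.
Unset Strict Implicit.
Unset Printing Implicit Defensive.

Import Order.TTheory GRing.Theory Num.Theory.
Import numFieldNormedType.Exports.

Local Open Scope classical_set_scope.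
Local Open Scope ring_scope.

(* A path on [0, oo[ is a function R -> R of which only the values on
   `[0, +oo[ matter. *)

Definition cpath (R : realType) : set (R -> R) :=
  [set psi : R -> R | {within `[0, +oo[, continuous psi} /\ psi 0 = 0].

Definition rcll (R : realType) (f : R -> R) : Prop :=
  (forall t, 0 <= t -> f s @[s --> t^'+] --> f t) /\
  (forall t, 0 < t -> cvg (f s @[s --> t^'-])).

Definition epath (R : realType) : set (R -> R) :=
  [set eta : R -> R | [/\ rcll eta,
                 {in `[0, +oo[ &, {homo eta : s t / s <= t}}
               & forall t, 0 <= t -> 0 <= eta t]].

Definition abs_continuous_on (R : realType) (a b : R) (f : R -> R) : Prop :=
  forall e : R, 0 < e -> exists2 d : R, 0 < d &
    forall (n : nat) (u v : 'I_n -> R),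
      (forall i, a <= u i /\ u i <= v i /\ v i <= b) ->
      trivIset setT (fun i => [set` `]u i, v i[]) ->
      \sum_(i < n) (v i - u i) < d ->
      \sum_(i < n) `|f (v i) - f (u i)| < e.

(* [derive1] is the total derivative of the library; for absolutely continuous
   psi it is the derivative almost everywhere. *)
Definition energy (R : realType) (c1 c2 T : R) (psi : (R -> R) * (R -> R))
    : \bar R :=
  if `[< abs_continuous_on 0 T psi.1 /\ abs_continuous_on 0 T psi.2 >] then
    (\int[lebesgue_measure]_(s in `[0%R, T])
       (c1 * (derive1 psi.1 s) ^+ 2 + c2 * (derive1 psi.2 s) ^+ 2)%:E)%E
  else +oo%E.

Definition free_path (R : realType) (x y : R) (psi : (R -> R) * (R -> R))
    : R -> R :=
  fun t => x + y * t + psi.1 t - psi.2 t.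

Definition dynamics (R : realType) (x y : R) (psi ctl : (R -> R) * (R -> R))
    : R -> R :=
  fun t => x + y * t + psi.1 t - psi.2 t + ctl.1 t - ctl.2 t.

(* In [\bar R], [a - +oo = -oo] for every [a], so the cost is -oo whenever the
   energy is infinite, whatever the control is. *)
Definition cost (R : realType) (c1 c2 r y : R) (h : R -> R) (x T : R)
    (psi ctl : (R -> R) * (R -> R)) : \bar R :=
  (\int[lebesgue_measure]_(t in `[0%R, T]) (h (dynamics x y psi ctl t))%:E
   + (r * ctl.2 T)%:E - energy c1 c2 T psi)%E.

(* The value of a strategy [alpha] : psi |-> (zeta, rho). *)
Definition J (R : realType) (c1 c2 r y : R) (h : R -> R) (x : R)
    (alpha : (R -> R) * (R -> R) -> (R -> R) * (R -> R)) : \bar R :=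
  ereal_sup [set k | exists psi T,
    [/\ cpath psi.1, cpath psi.2, 0 <= T
      & k = cost c1 c2 r y h x T psi (alpha psi)]].

(* The integral of [f] over [0, oo[ against d eta vanishes, where eta(0-) = 0:
   the measure is that of the extension of eta by 0 to negative times, so
   that it has an atom of mass eta(0) at time 0. *)
Definition stieltjes_null (R : realType) (eta f : R -> R) : Prop :=
  exists F : cumulative R R,
    (forall t, F t = if t < 0 then 0 else eta t) /\
    (\int[lebesgue_stieltjes_measure F]_(t in `[0%R, +oo[) (f t)%:E = 0)%E.

(* The graph of the Skorohod map on [a, b]:
   (phi, eta1, eta2) is the image of omega. *)
Definition skorohod (R : realType) (a b : R) (omega phi eta1 eta2 : R -> R)
    : Prop :=
  [/\ forall t, 0 <= t -> phi t = omega t + eta1 t - eta2 t,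
      forall t, 0 <= t -> phi t \in `[a, b],
      epath eta1 /\ epath eta2,
      stieltjes_null eta1 (fun t => \1_([set` `]a, b]] : set R) (phi t))
    & stieltjes_null eta2 (fun t => \1_([set` `[a, b[] : set R) (phi t))].

Definition drift (R : realType) (y : R) (psi : (R -> R) * (R -> R)) : R -> R :=
  fun s => derive1 psi.1 s - derive1 psi.2 s + y.

(* For beta = 0 the controls are prescribed only as long as psi is absolutely
   continuous; otherwise the energy is +oo and the cost is -oo. *)
Definition barrier_strategy (R : realType) (y beta x : R)
    (alpha : (R -> R) * (R -> R) -> (R -> R) * (R -> R)) : Prop :=
  forall psi, cpath psi.1 -> cpath psi.2 ->
    if beta == 0 then
      forall T, 0 <= T ->
        abs_continuous_on 0 T psi.1 -> abs_continuous_on 0 T psi.2 ->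
        forall t, t \in `[0, T] ->
          (alpha psi).1 t =
            \int[lebesgue_measure]_(s in `[0, t]) Num.max (- drift y psi s) 0 /\
          (alpha psi).2 t =
            x + \int[lebesgue_measure]_(s in `[0, t]) Num.max (drift y psi s) 0
    else exists phi,
      skorohod 0 beta (free_path x y psi) phi (alpha psi).1 (alpha psi).2.

Definition cpar (R : realType) (c1 c2 : R) : R := (c1^-1 + c2^-1)^-1.

(* Intended for r / (4 * c) <= - y, that is r ^+ 2 / (4 * c) + r * y <= 0. *)
Definition beta0 (R : realType) (D r c y : R) (h : R -> R) : R :=
  if - h D <= r ^+ 2 / (4 * c) + r * y then
    'pinv_(fun=> 0) `[0, D] h (- (r ^+ 2 / (4 * c)) - r * y)
  else D.

Definition gint (R : realType) (c y : R) (h : R -> R) (x : R) : R :=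
  \int[lebesgue_measure]_(u in `[0, x])
    (2 * c * (- y - Num.sqrt (y ^+ 2 - h u / c))).

Definition g (R : realType) (D r c y : R) (h : R -> R) (x : R) : R :=
  let b := beta0 D r c y h in
  if x <= b then gint c y h x else gint c y h b + r * (x - b).

(* Main.v *)
Require Import Defs.
From HB Require Import structures.
From mathcomp Require Import all_boot all_order all_algebra.
From mathcomp Require Import all_classical all_reals all_analysis.
From mathcomp Require Import measurable_realfun.
From mathcomp Require Import ring lra.
Import Order.TTheory GRing.Theory Num.Theory.
Import numFieldNormedType.Exports.
Local Open Scope classical_set_scope.
Local Open Scope ring_scope.

(* Let c = (1/c1 + 1/c2)^-1 and H(p, z) = p^2/(4c) + y p + h(z).  The function g
   satisfies g'(0) = 0, 0 <= g' <= r and H(g'(z), z) = 0 on [0, beta0], and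
   H(r, beta0) <= 0.

   Upper bound: c1 a^2 + c2 b^2 >= p (a - b) - p^2/(4c) for every p, so along any
   absolutely continuous disturbance the quantity
   int_0^t h(phi) + r rho(t) - I(t, psi) + g(phi(t)) is nonincreasing: away from the
   barriers take p = g'(phi), and while phi stays at beta0 take p = r.  Instead of a
   chain rule for phi, this is shown locally to the right of each time, up to an error
   eps, and propagated by induction along the real line.  Since I involves pointwise
   derivatives, the fundamental theorem of calculus for absolutely continuous functions
   is needed; it is obtained from total variation, the Radon-Nikodym theorem for the
   Stieltjes measure, and Lebesgue differentiation.

   Lower bound: the path X' = - (sqrt(y^2 - h(X)/c) + d), X(0) = min(x, beta0), run until
   it reaches 0, loses at most a multiple of d with respect to g.  The barrier
   strategy cannot push the controlled path below X. *)

Set Implicit Arguments.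
Unset Strict Implicit.

(** The assumption on y says H(r, 0) <= 0, and [beta0] is the largest state in [0, D] with H(r, .)
    <= 0. Below the barrier r therefore lies between the two roots of the convex quadratic H(., z),
    and g' is the smaller root; this is where g' <= r comes from, and why p = r is admissible at the
    barrier. The difficulty of the upper bound is that the controls merely have bounded variation
    and may act whenever the path meets a barrier. Only increments over short intervals are
    compared, with p frozen at g'(phi(t0)). The resulting error is a small multiple of elapsed
    energy plus elapsed time, a quantity that is additive in time and finite, so the local errors do
    not accumulate. The case beta0 = 0 is separate: the interval [0, beta0] degenerates, the
    strategy is given by explicit integrals of the drift, and Young's inequality with p = r, applied
    at almost every time, already suffices. The lower bound for positive beta0 uses the equality
    case of Young's inequality, up to the speed d; for x = 0 or beta0 = 0 the game stopped at time 0
    is enough. *)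

Section nonmeasurable_integrands.
Context d (T : measurableType d) (R : realType).
Variable mu : {measure set T -> \bar R}.
Import HBNNSimple.
Local Open Scope ereal_scope.

(** The integral of a nonnegative function is a supremum over the simple functions below it, so
    monotonicity survives without measurability. *)
Lemma ge0_le_integral_nonmeas (D : set T) (f g : T -> \bar R) :
  (forall x, D x -> 0 <= f x) -> (forall x, D x -> f x <= g x) ->
  \int[mu]_(x in D) f x <= \int[mu]_(x in D) g x.
Proof.
move=> f0 fg.
have g0 x : D x -> 0 <= g x by move=> Dx; rewrite (le_trans (f0 _ Dx))// fg.
rewrite !ge0_integralE//.
apply: le_ereal_sup => _ [h /= hf <-]; exists h => //= x.
rewrite (le_trans (hf x))// !patchE; case: ifPn => // /set_mem; exact: fg.
Qed.

Lemma ge0_ae_eq_integral_nonmeas (D : set T) (f g : T -> \bar R) :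
  measurable D -> measurable_fun D f ->
  (forall x, D x -> 0 <= f x) -> (forall x, D x -> 0 <= g x) ->
  {ae mu, forall x, D x -> g x = f x} ->
  \int[mu]_(x in D) g x = \int[mu]_(x in D) f x.
Proof.
move=> mD mf f0 g0 [N [mN N0 subN]].
have gfN x : D x -> ~ N x -> g x = f x.
  move=> Dx; apply: contra_notP => gf; apply: subN => /=; exact/not_implyP.
have mfN : measurable_fun (D `\` N) f.
  by apply: measurable_funS mf => //; exact: subDsetl.
apply/eqP; rewrite eq_le; apply/andP; split; last first.
  rewrite (ge0_negligible_integral mN)//.
  rewrite integral_mkcond [leRHS]integral_mkcond.
  apply: ge0_le_integral_nonmeas => x _.
    by rewrite patchE; case: ifPn => // /set_mem[Dx _]; exact: f0.
  rewrite !patchE; case: ifPn => [/set_mem[Dx Nx]|_].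
    by rewrite mem_set// gfN.
  by case: ifPn => // /set_mem; exact: g0.
rewrite [leLHS]integral_mkcond ge0_integralTE; last first.
  by move=> x; rewrite patchE; case: ifPn => // /set_mem; exact: g0.
apply: ge_ereal_sup => _ [h /= hg <-].
rewrite -integralT_nnsfun (ge0_negligible_integral mN)//; last 2 first.
- exact/measurable_EFinP/measurable_funP.
- by move=> x _; rewrite lee_fin.
rewrite [leRHS](ge0_negligible_integral mN mD)//.
rewrite integral_mkcond [leRHS]integral_mkcond.
apply: ge0_le_integral_nonmeas => x _.
  by rewrite patchE; case: ifPn => // _; rewrite lee_fin.
rewrite !patchE; case: ifPn => [/set_mem[_ Nx]|xN].
  have := hg x; rewrite patchE; case: ifPn => [/set_mem Dx|xD hx].
    by rewrite mem_set// gfN.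
  by rewrite ifN// notin_setE; move=> [] /mem_set; rewrite (negbTE xD).
by rewrite ifN//; move: xN; rewrite !notin_setE => Nx [_ ?]; apply: Nx; split.
Qed.

End nonmeasurable_integrands.

(** * Absolutely continuous functions *)

Section absolutely_continuous_functions.
Context (R : realType).
Implicit Types (a b e d : R) (f : R -> R).
Notation mu := (@lebesgue_measure R).

(** The index is an arbitrary finite type, so that cutting each interval of a family again gives a
    family, indexed by dependent pairs. *)
Definition ac_modulus a b f e d := forall (I : finType) (u v : I -> R),
  (forall i, a <= u i /\ u i <= v i /\ v i <= b) ->
  trivIset setT (fun i => [set` `]u i, v i[]) ->
  \sum_i (v i - u i) < d -> \sum_i `|f (v i) - f (u i)| < e.

Lemma abs_continuous_onP a b f : abs_continuous_on a b f ->
  forall e, 0 < e -> exists2 d, 0 < d & ac_modulus a b f e d.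
Proof.
move=> acf e /acf[d d0 H]; exists d => // I u v uv tuv.
rewrite (reindex (@enum_val I predT)); last exact/onW_bij/enum_val_bij.
rewrite [X in _ -> X < _](reindex (@enum_val I predT)); last first.
  exact/onW_bij/enum_val_bij.
move=> sd; apply: (H _ (u \o enum_val) (v \o enum_val)) => //=.
move=> i j _ _ ij; apply: enum_val_inj; exact: tuv.
Qed.

(** Refining every interval by its partition gives one disjoint family of the same total length, so
    [d] controls variations as well. *)
Lemma ac_modulus_variation a b f e d : ac_modulus a b f e d ->
  forall (I : finType) (u v : I -> R) (s : I -> seq R),
  (forall i, a <= u i /\ u i <= v i /\ v i <= b) ->
  trivIset setT (fun i => [set` `]u i, v i[]) ->
  (forall i, itv_partition (u i) (v i) (s i)) ->
  \sum_i (v i - u i) < d -> \sum_i variation (u i) (v i) f (s i) < e.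
Proof.
move=> H I u v s uv tuv ps sd.
pose J i := 'I_(size (s i)).
pose P (i : I) (k : nat) := nth (v i) (u i :: s i) k.
have Pge i k : (k <= size (s i))%N -> u i <= P i k.
  by move=> ks; apply: itv_partition_nth_ge.
have Ple i k : (k <= size (s i))%N -> P i k <= v i.
  by move=> ks; apply: itv_partition_nth_le.
have Plt i k l : (k < l)%N -> (l <= size (s i))%N -> P i k < P i l.
  move=> kl ls; rewrite /P lt_sorted_ltn_nth//= ?inE ?ltnS//; last first.
    by rewrite (leq_trans (ltnW kl)).
  by have [] := ps i.
have sumE (F : I -> nat -> R) : \sum_i \sum_(0 <= k < size (s i)) F i k =
    \sum_(p : {i : I & J i}) F (tag p) (tagged p).
  rewrite (eq_bigr (fun i => \sum_(k < size (s i)) F i k)); last first.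
    by move=> i _; rewrite big_mkord.
  by rewrite (@sig_big_dep _ _ _ _ J predT (fun _ => predT) (fun i k => F i k)).
rewrite /variation (sumE (fun i k => `|f (P i k.+1) - f (P i k)|)).
apply: (H _ (fun p : {i : I & J i} => P (tag p) (tagged p))
            (fun p : {i : I & J i} => P (tag p) (tagged p).+1)) => /=.
- move=> [i k]/=; have [ai [_ vb]] := uv i.
  rewrite (le_trans ai) ?Pge//; last exact: ltnW.
  by rewrite (le_trans _ vb) ?Ple// ltW// Plt.
- move=> [i k] [j l] _ _ [x /= []]; rewrite !in_itv/= => /andP[xi1 xi2].
  move=> /andP[xj1 xj2].
  have ij : i = j.
    apply: tuv => //; exists x; rewrite /= !in_itv/=; split.
      rewrite (le_lt_trans _ xi1) ?Pge ?(lt_le_trans xi2) ?Ple//.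
      exact: ltnW.
    rewrite (le_lt_trans _ xj1) ?Pge ?(lt_le_trans xj2) ?Ple//.
    exact: ltnW.
  subst j; congr existT; apply: val_inj => /=.
  have lem (k' l' : 'I_(size (s i))) : (k' < l')%N ->
      x < P i k'.+1 -> P i l' < x -> False.
    move=> kl xk lx; have : P i k'.+1 <= P i l'.
      move: kl; rewrite leq_eqVlt => /predU1P[->//|kl].
      by rewrite ltW// Plt// ltnW.
    by move=> /(lt_le_trans xk)/lt_trans/(_ lx); rewrite ltxx.
  by case: (ltngtP k l) => // kl; [case: (lem k l)|case: (lem l k)].
- rewrite -(sumE (fun i k => P i k.+1 - P i k)).
  rewrite (eq_bigr (fun i => v i - u i))// => i _.
  by rewrite telescope_sumr// /P (itv_partition_nth_size _ (ps i)).
Qed.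

Lemma ac_modulus_bounded_variation a b f e d x y : ac_modulus a b f e d ->
  a <= x -> x <= y -> y <= b -> y - x < d -> bounded_variation x y f.
Proof.
move=> H ax xy yb yxd; exists e => _ [s xys <-]; apply/ltW.
have := @ac_modulus_variation _ _ _ _ _ H 'I_1 (fun=> x) (fun=> y) (fun=> s).
rewrite !big_ord1; apply => // i j _ _ _.
by rewrite (ord1 i) (ord1 j).
Qed.

Lemma abs_continuous_bounded_variation a b f : a <= b ->
  abs_continuous_on a b f -> bounded_variation a b f.
Proof.
move=> ab /abs_continuous_onP /(_ 1 ltr01)[d d0 H].
(* Enough equal pieces to make each shorter than [d]; the variation over each piece is then finite,
   and finitely many add up. *)
pose N := (Num.truncn ((b - a) / d)).+1.
have N0 : 0 < N%:R :> R by rewrite ltr0n.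
have Nd : (b - a) / N%:R < d.
  rewrite ltr_pdivrMr// mulrC -ltr_pdivrMr//.
  by have /andP[] := truncn_itv (divr_ge0 (etrans (subr_ge0 _ _) ab) (ltW d0)).
pose p k := a + (b - a) / N%:R * k%:R.
have pS k : p k.+1 - p k = (b - a) / N%:R by rewrite /p -natr1; ring.
have pk k : p k <= p k.+1 by rewrite -subr_ge0 pS divr_ge0// subr_ge0.
have ap k : a <= p k.
  by rewrite /p lerDl mulr_ge0// divr_ge0// subr_ge0.
have pN : p N = b by rewrite /p divfK ?gt_eqF//; ring.
suff Hk k : (k <= N)%N -> bounded_variation a (p k) f by rewrite -pN; exact: Hk.
elim: k => [_|k ih kN]; first by rewrite /p mulr0 addr0; exact: bounded_variationxx.
have pb : p k.+1 <= b.
  by rewrite -pN /p lerD2l ler_wpM2l// ?ler_nat// divr_ge0// subr_ge0.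
have /(bounded_variationP _ (ap k)) h1 := ih (ltnW kN).
have : bounded_variation (p k) (p k.+1) f.
  by apply: (ac_modulus_bounded_variation H (ap k) (pk k) pb); rewrite pS.
move=> /(bounded_variationP _ (pk k)) h2.
by apply/bounded_variationP => //; rewrite (total_variationD f (ap k) (pk k)) fin_numD h1.
Qed.

Lemma abs_continuous_total_variation a b f : a <= b ->
  abs_continuous_on a b f ->
  abs_continuous_on a b (fun x => fine (total_variation a x f)).
Proof.
move=> ab acf e e0; have bvf := abs_continuous_bounded_variation ab acf.
have e20 : 0 < e / 2 by rewrite divr_gt0.
have [d d0 H] := abs_continuous_onP acf e20.
exists d => // n u v uv tuv sd.
have fin x y : a <= x -> x <= y -> y <= b -> total_variation x y f \is a fin_num.
  move=> ax xy yb; apply/bounded_variationP => //.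
  by apply: (bounded_variationr ax xy); apply: (bounded_variationl _ yb) => //; exact: le_trans xy.
(* Each total variation is approximated within [eta], so the [n] errors add up to at most e / 2;
   [n.+1] covers the empty family. *)
pose eta := e / 2 / n.+1%:R.
have eta0 : 0 < eta by rewrite divr_gt0.
have /choice[s hs] : forall i, exists s, itv_partition (u i) (v i) s /\
    `|fine (total_variation a (v i) f) - fine (total_variation a (u i) f)| <=
    variation (u i) (v i) f s + eta.
  move=> i; have [ai [uvi vb]] := uv i.
  have fuv := fin _ _ ai uvi vb.
  rewrite (total_variationD f ai uvi) fineD//; last first.
    by rewrite fin//(le_trans uvi).
  rewrite addrAC subrr add0r ger0_norm ?fine_ge0 ?total_variation_ge0//.
  have [_ [_ [s us <-] <-]] := ub_ereal_sup_adherent eta0 fuv.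
  rewrite -/(total_variation _ _ _) => h; exists s; split => //.
  by rewrite -lee_fin EFinD fineK// -leeBlDr// ltW.
have : \sum_i variation (u i) (v i) f (s i) < e / 2.
  by apply: (ac_modulus_variation H) => // i; have [] := hs i.
move=> h; apply: (@le_lt_trans _ _ (\sum_i (variation (u i) (v i) f (s i) + eta))).
  by apply: ler_sum => i _; have [] := hs i.
rewrite big_split/= sumr_const card_ord (splitr e) ltr_leD//.
by rewrite -[leLHS]mulr_natr mulrAC ler_pdivrMr// ler_wpM2l ?ler_nat// ltW.
Qed.

End absolutely_continuous_functions.

(** * Lebesgue-Stieltjes measures *)

Section lebesgue_stieltjes.
Context (R : realType).
Notation mu := (@lebesgue_measure R).

Lemma lebesgue_stieltjes_itvoc (F : cumulative R R) (a b : R) : a <= b ->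
  lebesgue_stieltjes_measure F `]a, b] = (F b - F a)%:E.
Proof.
move=> ab; rewrite /lebesgue_stieltjes_measure /measure_extension.
by rewrite measurable_mu_extE/= ?wlength_itv_bnd//; exact: is_ocitv.
Qed.

(* An open set is the increasing union of the dyadic intervals of a given level that it
   contains; these are disjoint, so absolute continuity applies to each level. *)
Lemma open_stieltjes_le (F : cumulative R R) (T e d : R) (U : set R) : 0 < T ->
  (forall n (u v : 'I_n -> R),
    (forall i, 0 <= u i /\ u i <= v i /\ v i <= T) ->
    trivIset setT (fun i => [set` `]u i, v i[]) ->
    \sum_i (v i - u i) < d -> \sum_i `|F (v i) - F (u i)| < e) ->
  open U -> (mu U < d%:E)%E ->
  (lebesgue_stieltjes_measure F (U `&` `]0%R, T]) <= e%:E)%E.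
Proof.
move=> T0 acF oU Ud.
pose p (n k : nat) : R := T * k%:R / (2 ^ n)%:R.
have e2 n : 0 < (2 ^ n)%:R :> R by rewrite ltr0n expn_gt0.
have p0 n : p n 0%N = 0 by rewrite /p mulr0 mul0r.
have pT n : p n (2 ^ n)%N = T by rewrite /p mulfK// gt_eqF.
have le_p n : {mono p n : k l / (k <= l)%N >-> k <= l}.
  by move=> k l; rewrite /p ler_pM2r ?invr_gt0// ler_pM2l// ler_nat.
have lt_p n : {mono p n : k l / (k < l)%N >-> k < l}.
  by move=> k l; rewrite /p ltr_pM2r ?invr_gt0// ltr_pM2l// ltr_nat.
have p2 n k : p n.+1 k.*2 = p n k.
  rewrite /p expnS -mul2n !natrM invfM -!mulrA; congr (_ * _).
  by rewrite mulrCA mulVKf.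
pose I n k : set R := `]p n k, p n k.+1]%classic.
pose P n (k : 'I_(2 ^ n)) := `[< I n k `<=` U >].
pose W n := \big[setU/set0]_(k < 2 ^ n | P n k) I n k.
have WE n x : W n x <-> exists2 k : 'I_(2 ^ n), I n k `<=` U & I n k x.
  rewrite /W -bigcup_pred; split=> [[k /asboolP kU kx]|[k kU kx]]; exists k => //.
  exact/asboolP.
have mW n : measurable (W n).
  by apply: bigsetU_measurable => k _; exact: measurable_itv.
have WU : U `&` `]0%R, T] = \bigcup_n W n.
  apply/seteqP; split=> [x [Ux]|x [n _ /WE[k kU kx]]]; last first.
    split; first exact: kU.
    move: kx; rewrite /I /= !in_itv/= => /andP[kx xk].
    rewrite (le_lt_trans _ kx)/=; last by rewrite -(p0 n) le_p.
    by rewrite (le_trans xk)// -(pT n) le_p.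
  rewrite /= in_itv/= => /andP[x0 xT].
  have [r/= r0 rU] := open_itvoo_subset oU Ux.
  have {}rU : `]x - (r / 2), x + (r / 2)[ `<=` U.
    apply: rU => /=; last by rewrite divr_gt0.
    by rewrite sub0r normrN gtr0_norm ?divr_gt0// ltr_pdivrMr// ltr_pMr// ltr1n.
  have [n Tn] : exists n, T / (2 ^ n)%:R < r / 2.
    exists (Num.truncn (T / (r / 2))).+1.
    have r20 : 0 < r / 2 by rewrite divr_gt0.
    rewrite ltr_pdivrMr// mulrC -ltr_pdivrMr//.
    have /andP[_ h] := truncn_itv (divr_ge0 (ltW T0) (ltW r20)).
    by rewrite (lt_le_trans h)// ler_nat ltnW// ltn_expl.
  exists n => //; apply/WE.
  have exk : exists k, x <= p n k.+1.
    by exists (2 ^ n)%N; rewrite (le_trans xT)// -{1}(pT n) le_p.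
  case: (ex_minnP exk) => k xk kmin.
  have kx : p n k < x.
    case: k xk kmin => [|k] xk kmin; first by rewrite p0.
    by rewrite ltNge; apply/negP => /kmin; rewrite ltnn.
  have kn : (k < 2 ^ n)%N by rewrite -(lt_p n) pT (lt_le_trans kx).
  exists (Ordinal kn) => /=; last by rewrite /I /= in_itv/= kx.
  have pS : p n k.+1 - p n k < r / 2.
    by rewrite /p -mulrBl -mulrBr -natr1 [_ + 1]addrC addrK mulr1.
  move=> z; rewrite /I /= in_itv/= => /andP[kz zk]; apply: rU.
  rewrite /= in_itv/=; apply/andP; split; lra.
have ndW : nondecreasing_seq W.
  apply/nondecreasing_seqP => n; apply/subsetPset => x /WE[k kU kx].
  apply/WE; have k1 : (k.*2 < 2 ^ n.+1)%N.
    by rewrite expnS mul2n ltn_double.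
  have k2 : (k.*2.+1 < 2 ^ n.+1)%N.
    by rewrite expnS mul2n -doubleS leq_double.
  have k1U : I n.+1 k.*2 `<=` I n k.
    move=> z; rewrite /I /= !in_itv/= p2 => /andP[-> zk]/=.
    by rewrite (le_trans zk)// -(p2 n k.+1) le_p doubleS.
  have k2U : I n.+1 k.*2.+1 `<=` I n k.
    move=> z; rewrite /I /= !in_itv/= -doubleS p2 => /andP[kz ->].
    by rewrite (le_lt_trans _ kz)// -(p2 n k) le_p.
  have [xm|xm] := leP x (p n.+1 k.*2.+1).
    exists (Ordinal k1) => /=; first exact: subset_trans k1U kU.
    rewrite /I /= in_itv/= p2 xm andbT.
    by move: kx; rewrite /I /= in_itv/= => /andP[].
  exists (Ordinal k2) => /=; first exact: subset_trans k2U kU.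
  rewrite /I /= in_itv/= xm/= -doubleS p2.
  by move: kx; rewrite /I /= in_itv/= => /andP[].
have tI n : trivIset setT (fun k : 'I_(2 ^ n) => I n k).
  apply/trivIsetP => i j _ _ ij; apply/seteqP; split => // z [].
  rewrite /I /= !in_itv/= => /andP[iz zi] /andP[jz zj].
  have : (i < j.+1)%N by rewrite -(lt_p n) (lt_le_trans iz).
  have : (j < i.+1)%N by rewrite -(lt_p n) (lt_le_trans jz).
  rewrite !ltnS => ji ij'; move/eqP: ij; apply; apply/val_inj/eqP.
  by rewrite eqn_leq/= ji ij'.
have We n : (lebesgue_stieltjes_measure F (W n) <= e%:E)%E.
  have LS (G : cumulative R R) : lebesgue_stieltjes_measure G (W n) =
      (\sum_(k < 2 ^ n | P n k) (G (p n k.+1) - G (p n k)))%:E.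
    rewrite /W measure_bigsetU_ord//; last by move=> k; exact: measurable_itv.
    rewrite -sumEFin; apply: eq_bigr => k _.
    by apply: lebesgue_stieltjes_itvoc; rewrite le_p.
  rewrite LS lee_fin ltW//.
  (* Cells outside [U] become empty intervals, so the family stays indexed by all of ['I_(2 ^ n)]
     and these cells add nothing to either sum. *)
  pose v (k : 'I_(2 ^ n)) := if P n k then p n k.+1 else p n k.
  apply: le_lt_trans (acF _ (fun k : 'I_(2 ^ n) => p n k) v _ _ _).
  - rewrite [leRHS](bigID (fun k => P n k))/= ler_wpDr ?sumr_ge0//.
    by apply: ler_sum => k Pk; rewrite /v Pk ler_norm.
  - move=> k; split; first by rewrite -(p0 n) le_p.
    by rewrite /v; case: ifP; rewrite -(pT n) ?lexx ?le_p ?leqnSn// ltnW.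
  - have vI (k : 'I_(2 ^ n)) : [set` `]p n k, v k[] `<=` I n k.
      move=> z; rewrite /I /v /= !in_itv/=; case: ifP => _ /andP[-> zv].
        exact: ltW.
      by rewrite (le_trans (ltW zv))// le_p.
    move=> i j _ _ [z [zi zj]]; apply: (tI n) => //.
    by exists z; split; exact: vI.
  - rewrite -lte_fin (le_lt_trans _ Ud)//.
    apply: (@le_trans _ _ (mu (W n))).
      rewrite /mu LS lee_fin [leLHS](bigID (fun k => P n k))/=.
      rewrite [X in _ + X]big1 ?addr0; last first.
        by move=> k /negbTE Pk; rewrite /v Pk subrr.
      by apply: ler_sum => k Pk; rewrite /v Pk.
    have mU : measurable U by exact: open_measurable.
    apply: le_measure; [exact: (mem_set (mW n))|exact: (mem_set mU)|].
    by move=> x /WE[k kU kx]; exact: kU.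
have cW := nondecreasing_cvg_mu (mu := lebesgue_stieltjes_measure F) mW
  (bigcup_measurable (fun n _ => mW n)) ndW.
rewrite WU -(cvg_lim _ cW)//.
apply: lime_le; first by apply/cvg_ex; eexists; exact: cW.
exact: nearW.
Qed.

End lebesgue_stieltjes.

(** * Densities and derivatives of absolutely continuous functions *)

Section densities.
Context (R : realType).
Notation mu := (@lebesgue_measure R).

Lemma abs_continuous_onS (a b : R) f e : abs_continuous_on a b f -> 0 < e ->
  exists2 d, 0 < d & forall x y, a <= x -> x <= y -> y <= b -> y - x < d ->
    `|f y - f x| < e.
Proof.
move=> acf e0; have [d d0 H] := acf e e0; exists d => // x y ax xy yb xyd.
have := H 1%N (fun=> x) (fun=> y); rewrite !big_ord1; apply => //.
by move=> i j _ _ _; rewrite (ord1 i) (ord1 j).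
Qed.

Lemma abs_continuous_onB (a b : R) f g : abs_continuous_on a b f ->
  abs_continuous_on a b g -> abs_continuous_on a b (fun x => f x - g x).
Proof.
move=> acf acg e e0; have e20 : 0 < e / 2 by rewrite divr_gt0.
have [d1 d10 H1] := acf _ e20; have [d2 d20 H2] := acg _ e20.
exists (Num.min d1 d2); first by rewrite lt_min d10.
move=> n u v uv tuv; rewrite lt_min => /andP[s1 s2].
apply: le_lt_trans (_ : _ <= \sum_(i < n) (`|f (v i) - f (u i)| + `|g (v i) - g (u i)|)) _.
  apply: ler_sum => i _; apply: le_trans (ler_normB _ _).
  by rewrite le_eqVlt; apply/orP; left; apply/eqP; congr `|_|; ring.
by rewrite big_split/= (splitr e) ltrD// ?H1 ?H2.
Qed.

Lemma nondecreasing_abs_continuous_density (T : R) (F : R -> R) : 0 < T ->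
  {in `[0, T] &, nondecreasing_fun F} -> abs_continuous_on 0 T F ->
  exists2 d : R -> R, mu.-integrable setT (EFin \o d) &
    forall t, t \in `[0, T] -> F t - F 0 = \int[mu]_(s in `[0, t]) d s.
Proof.
move=> T0 ndF acF.
(* Clamping time to [0, T] turns [F] into a cumulative function on the whole line. *)
pose k (x : R) := Num.min (Num.max x 0) T.
have k_itv x : k x \in `[0, T].
  rewrite in_itv/= /k maxEle; repeat (case: ifPn; rewrite -?ltNge => ?);
  by rewrite minEle; repeat (case: ifPn; rewrite -?ltNge => ?); apply/andP; split; lra.
have kE x : x \in `[0, T] -> k x = x.
  by rewrite in_itv/= /k => /andP[x0 xT]; rewrite (max_idPl _)// (min_idPl _).
have ndk x y : x <= y -> k x <= k y.
  move=> xy; rewrite /k !maxEle; repeat (case: ifPn; rewrite -?ltNge => ?);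
  by rewrite !minEle; repeat (case: ifPn; rewrite -?ltNge => ?); lra.
have kB x y : x <= y -> k y - k x <= y - x.
  move=> xy; rewrite /k !maxEle; repeat (case: ifPn; rewrite -?ltNge => ?);
  by rewrite !minEle; repeat (case: ifPn; rewrite -?ltNge => ?); lra.
pose G x := F (k x).
have ndG : nondecreasing G.
  by move=> x y xy; apply: ndF => //; exact: ndk.
have rcG : right_continuous G.
  move=> x; apply/cvgrPdist_lt => e e0.
  have [d d0 H] := abs_continuous_onS acF e0.
  near=> y.
  have xy : x <= y by near: y; exact: nbhs_right_ge.
  rewrite distrC; apply: H; [|exact: ndk| |].
  - by have := k_itv x; rewrite in_itv => /andP[].
  - by have := k_itv y; rewrite in_itv => /andP[].
  - rewrite (le_lt_trans (kB _ _ xy))// ltrBlDl.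
    by near: y; apply: nbhs_right_lt; rewrite ltrDl.
pose C : cumulative R R := HB.pack G (isCumulative.Build R _ R G ndG rcG).
have CE x : x \in `[0, T] -> C x = F x by move=> xT; rewrite /C/= /G kE.
pose D : set (measurableTypeR R) := `]0%R, T]%classic.
have mD : measurable D by exact: measurable_itv.
have moo : (lebesgue_stieltjes_measure C D < +oo)%E.
  by rewrite /D lebesgue_stieltjes_itvoc ?ltW// ltry.
pose nu : {finite_measure set (measurableTypeR R) -> \bar R} :=
  mfrestr mD moo.
have num : nu `<< mu.
  (* Outer regularity encloses a null set in an open set of measure below [d], whose Stieltjes mass
     is small by [open_stieltjes_le]. *)
  apply/null_content_dominatesP => A mA muA0.
  apply/eqP; rewrite eq_le measure_ge0 andbT.
  apply/lee_addgt0Pr => e e0; rewrite add0e.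
  have [d d0 H] := acF _ e0.
  have muAoo : (mu A < +oo)%E by rewrite muA0.
  have [U [oU AU UAd]] := lebesgue_regularity_outer mA muAoo d0.
  have mU : measurable U by exact: open_measurable.
  have Ud : (mu U < d%:E)%E.
    rewrite (_ : U = (U `\` A) `|` A); last by rewrite setDKU.
    rewrite measureU//; [|exact: measurableD|by rewrite setDKI].
    by rewrite muA0 adde0.
  apply: le_trans (open_stieltjes_le T0 (F := C) _ oU Ud).
    by apply: le_measure; [exact: (mem_set mA)|exact: (mem_set mU)|].
  move=> n u v uv tuv sd.
  rewrite (eq_bigr (fun i => `|F (v i) - F (u i)|)); first exact: H.
  move=> i _; have [u0 [uiv vT]] := uv i.
  by rewrite !CE// in_itv/= ?u0 ?vT ?andbT ?(le_trans uiv)// (le_trans u0).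
have [f [f0 ffin fint fE]] := radon_nikodym_sigma_finite num.
exists (fine \o f).
  by apply: eq_integrable fint => // x _ /=; rewrite fineK.
move=> t tT; move: (tT); rewrite in_itv/= => /andP[t0 tT'].
have fint' : mu.-integrable setT (EFin \o (fine \o f)).
  by apply: eq_integrable fint => // x _ /=; rewrite fineK.
rewrite -(Rintegral_itv_obnd_cbnd (b := BRight t)); last first.
  exact: integrableS fint'.
rewrite /Rintegral.
under eq_integral do rewrite /= fineK//.
rewrite -fE; last exact: measurable_itv.
rewrite /nu/= /mfrestr /mrestr setIidl; last first.
  by move=> z; rewrite /D /= !in_itv/= => /andP[-> zt]; rewrite (le_trans zt).
by rewrite lebesgue_stieltjes_itvoc// !CE// in_itv/= lexx ltW.
Unshelve. all: by end_near. Qed.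

End densities.

Section lebesgue_theorem.
Context (R : realType).
Notation mu := (@lebesgue_measure R).

Lemma ae_neq (a : R) : {ae mu, forall x, x <> a}.
Proof.
exists [set a]; split; first exact: measurable_set1.
  exact: lebesgue_measure_set1.
by move=> x /= /contrapT.
Qed.

(** [f] is the difference of its variation function [V] and [V - f], both nondecreasing and
    absolutely continuous, so both have densities. *)
Lemma abs_continuous_density (T : R) (f : R -> R) : 0 <= T ->
  abs_continuous_on 0 T f ->
  exists d : R -> R, [/\ mu.-integrable setT (EFin \o d),
    forall t, t \in `[0, T] -> f t - f 0 = \int[mu]_(s in `[0, t]) d s &
    {ae mu, forall x, x \in `[0, T] -> f^`()%classic x = d x}].
Proof.
rewrite le_eqVlt => /predU1P[<- _|T0 acf].
  exists (cst 0); split; first exact: integrable0.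
    by move=> t; rewrite itvxx => /eqP ->; rewrite subrr set_itv1 Rintegral_set1.
  apply: filterS (ae_neq 0); first exact: (ae_filter_ringOfSetsType mu).
  by move=> x x0; rewrite itvxx => /eqP.
have T0' := ltW T0.
pose V x := fine (total_variation 0 x f).
have acV : abs_continuous_on 0 T V by exact: abs_continuous_total_variation.
have bvf := abs_continuous_bounded_variation T0' acf.
have fin x y : 0 <= x -> x <= y -> y <= T -> total_variation x y f \is a fin_num.
  move=> x0 xy yT; apply/bounded_variationP => //.
  apply: (bounded_variationr x0 xy); apply: (bounded_variationl _ yT) => //.
  exact: le_trans xy.
have VB x y : 0 <= x -> x <= y -> y <= T -> V y - V x = fine (total_variation x y f).
  move=> x0 xy yT; rewrite /V (total_variationD f x0 xy) fineD.
  - by rewrite addrAC subrr add0r.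
  - by apply: fin => //; exact: le_trans yT.
  - exact: fin.
have ndV : {in `[0, T] &, nondecreasing_fun V}.
  move=> x y; rewrite !in_itv/= => /andP[x0 xT] /andP[y0 yT] xy.
  by rewrite -subr_ge0 VB// fine_ge0// total_variation_ge0.
have ndVf : {in `[0, T] &, nondecreasing_fun (fun x => V x - f x)}.
  move=> x y; rewrite !in_itv/= => /andP[x0 xT] /andP[y0 yT] xy.
  rewrite -subr_ge0 [leRHS](_ : _ = V y - V x - (f y - f x)); last by ring.
  rewrite VB// subr_ge0 (le_trans (ler_norm _))// -lee_fin fineK ?fin//.
  exact: total_variation_ge.
have [d1 id1 d1E] := nondecreasing_abs_continuous_density T0 ndV acV.
have [d2 id2 d2E] := nondecreasing_abs_continuous_density T0 ndVf
  (abs_continuous_onB acV acf).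
pose d x := d1 x - d2 x.
have id : mu.-integrable setT (EFin \o d).
  rewrite [X in mu.-integrable _ X](_ : _ = (EFin \o d1) \- (EFin \o d2))%E.
    exact: integrableB.
  by apply/funext => x/=; rewrite EFinB.
have dE t : t \in `[0, T] -> f t - f 0 = \int[mu]_(s in `[0, t]) d s.
  move=> tT; rewrite RintegralB//.
  - by rewrite -d1E// -d2E//; ring.
  - exact: integrableS id1.
  - exact: integrableS id2.
exists d; split => //.
have lid : locally_integrable setT d.
  by have := integrable_locally measurableT id; rewrite patch_setT.
pose F (x : R) := \int[mu]_(s in `[0, x]) d s.
have h : {ae mu, forall x : R, 0 < x -> derivable F x 1 /\ F^`()%classic x = d x}.
  have idi (i : interval R) : mu.-integrable [set` i] (EFin \o d).
    exact: integrableS id.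
  have := @FTC1 _ d (BLeft 0) (fun y => idi _) lid.
  apply: filterS; first exact: (ae_filter_ringOfSetsType mu).
  by move=> x + x0; apply; rewrite lte_fin.
(* The endpoints are discarded: the two-sided derivative there depends on values of [f] outside
   [0, T]. *)
have h0 := ae_neq 0; have hT := ae_neq T.
apply: filterS3 h h0 hT; first exact: (ae_filter_ringOfSetsType mu).
move=> x hx x0 xT; rewrite in_itv/= => /andP[x0' xT'].
have {}x0 : 0 < x by rewrite lt_neqAle x0' andbT eq_sym; exact/eqP.
have {}xT : x < T by rewrite lt_neqAle xT' andbT; exact/eqP.
have [dFx <-] := hx x0.
rewrite !derive1E.
transitivity ('D_1 (F + cst (f 0)) x); last first.
  by rewrite (deriveD dFx (derivable_cst (f 0) x 1)) derive_cst addr0.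
apply: near_eq_derive; near=> y.
have -> : (F + cst (f 0)) y = F y + f 0 by [].
rewrite /F -dE ?subrK// in_itv/=; apply/andP; split; apply: ltW; near: y.
  exact: lt_nbhsr.
exact: lt_nbhsl.
Unshelve. all: by end_near. Qed.

End lebesgue_theorem.

(** * Skorohod problem *)

Section stieltjes_null_facts.
Context (R : realType).

(** Continuity from above along the intervals ]t - 1/(n+1), t], which shrink to the singleton:
    without an atom at [t], [F] is left-continuous there. *)
Lemma lebesgue_stieltjes_atom (F : cumulative R R) (t e : R) :
  lebesgue_stieltjes_measure F [set t] = 0 -> 0 < e ->
  exists2 s, s < t & F t - F s < e.
Proof.
move=> Ft0 e0.
pose B (n : nat) : set R := `]t - n.+1%:R^-1, t]%classic.
have mB n : measurable (B n) by exact: measurable_itv.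
have BI : \bigcap_n B n = [set t].
  apply/seteqP; split=> [x Bx|x -> n _]; last first.
    by rewrite /B /= in_itv/= lexx andbT gtrBl invr_gt0.
  have xt : x <= t by have := Bx 0%N I; rewrite /B /= in_itv/= => /andP[].
  apply/eqP; rewrite eq_le xt /=; apply/ler_addgt0Pl => d d0.
  have [n nd] : exists n : nat, n.+1%:R^-1 < d.
    exists (Num.truncn d^-1); rewrite invf_plt ?posrE//.
    by have /andP[] := truncn_itv (ltW (etrans (invr_gt0 _) d0)).
  have := Bx n I; rewrite /B /= in_itv/= => /andP[+ _].
  by move: (n.+1%:R^-1) nd => k; lra.
have FB n : lebesgue_stieltjes_measure F (B n) = (F t - F (t - n.+1%:R^-1))%:E.
  by apply: lebesgue_stieltjes_itvoc; rewrite gerBl invr_ge0.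
have niB : nonincreasing_seq B.
  apply/nonincreasing_seqP => n; apply/subsetPset => x.
  rewrite /B /= !in_itv/= => /andP[xn ->]; rewrite andbT (le_lt_trans _ xn)//.
  by rewrite lerD2l lerN2 lef_pV2 ?posrE// ler_nat.
have mBI : measurable (\bigcap_n B n) by exact: bigcap_measurable.
have : lebesgue_stieltjes_measure F (B n) @[n --> \oo] --> 0%E.
  rewrite -Ft0 -BI; apply: nonincreasing_cvg_mu => //.
  by rewrite [ltLHS](FB 0%N) ltry.
under eq_fun do rewrite FB.
move=> /fine_cvgP[_ /cvgrPdist_lt /(_ _ e0)[n _ /(_ n)]].
move=> /(_ (leqnn n)); rewrite /= sub0r normrN/= => h.
exists (t - n.+1%:R^-1); first by rewrite gtrBl invr_gt0.
exact: le_lt_trans (ler_norm _) h.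
Qed.

Variables (eta phi : R -> R) (A : set R).
Hypothesis etaA : stieltjes_null eta (fun t => \1_A (phi t)).

(** On the half-line the indicator of [B] is below that of [A] composed with [phi], whose integral
    vanishes; the comparison is made with no measurability of [phi] in hand. *)
Lemma stieltjes_null_measure : exists F : cumulative R R,
  (forall t, F t = if t < 0 then 0 else eta t) /\
  forall B : set R, measurable B -> B `<=` `[0, +oo[ ->
    (forall t, B t -> A (phi t)) -> lebesgue_stieltjes_measure F B = 0.
Proof.
have [F [FE Fi]] := etaA; exists F; split => // B mB B0 BA.
apply/eqP; rewrite eq_le measure_ge0 andbT -Fi.
have -> : lebesgue_stieltjes_measure F B =
    (\int[lebesgue_stieltjes_measure F]_(t in `[0%R, +oo[) (\1_B t)%:E)%E.
  by rewrite integral_indic//= setIidl.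
apply: ge0_le_integral_nonmeas => t _; first by rewrite lee_fin.
rewrite lee_fin !indicE; case: (boolP (t \in B)) => //= /set_mem /BA tA.
by rewrite mem_set.
Qed.

Lemma stieltjes_null_cst (s t : R) : 0 <= s -> s <= t ->
  (forall u, s < u -> u <= t -> A (phi u)) -> eta t = eta s.
Proof.
move=> s0 st stA; have [F [FE FB]] := stieltjes_null_measure.
have : lebesgue_stieltjes_measure F `]s, t] = 0.
  apply: FB; first exact: measurable_itv.
    by move=> u; rewrite /= !in_itv/= andbT => /andP[su _]; rewrite (le_trans s0)// ltW.
  by move=> u; rewrite /= !in_itv/= => /andP[]; exact: stA.
rewrite lebesgue_stieltjes_itvoc// !FE !ltNge s0 (le_trans s0 st)/= => -[/eqP].
by rewrite subr_eq0 => /eqP.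
Qed.

(** The conditional is the extension of [eta] by 0 to negative times, so one statement covers both
    the jump at time 0 and left continuity at later times. *)
Lemma stieltjes_null_atom (t e : R) : 0 <= t -> A (phi t) -> 0 < e ->
  exists2 s, s < t & eta t - (if s < 0 then 0 else eta s) < e.
Proof.
move=> t0 At e0; have [F [FE FB]] := stieltjes_null_measure.
have [|s st] := @lebesgue_stieltjes_atom F t e _ e0.
  apply: FB => //.
    by move=> _ ->; rewrite /= in_itv/= t0.
  by move=> _ ->.
by rewrite !FE (ltNge t) t0/= => h; exists s.
Qed.

Lemma stieltjes_null_start : 0 <= eta 0 -> A (phi 0) -> eta 0 = 0.
Proof.
move=> e0 A0; apply/eqP; rewrite eq_le e0 andbT; apply/ler_addgt0Pl => e e_gt0.
have [s s0] := stieltjes_null_atom (lexx 0) A0 e_gt0.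
by rewrite s0 subr0 addr0 => /ltW.
Qed.

Lemma stieltjes_null_left (t e : R) : 0 < t -> A (phi t) -> 0 < e ->
  {in `[0, +oo[ &, {homo eta : s t / s <= t}} ->
  exists s, [/\ 0 <= s, s < t & forall u, s <= u -> u <= t -> eta t - eta u < e].
Proof.
move=> t0 At e0 nd; have [s st se] := stieltjes_null_atom (ltW t0) At e0.
have [F [FE _]] := etaA.
exists (Num.max s 0); split; first by rewrite le_max lexx orbT.
  by rewrite gt_max st.
move=> u; rewrite ge_max => /andP[su u0] ut.
apply: le_lt_trans se; rewrite lerB//; case: ifPn => s0.
  have := cumulative_is_nondecreasing F _ _ su.
  by rewrite !FE s0 ltNge u0.
by apply: nd; rewrite // in_itv/= ?u0// leNgt s0.
Qed.

End stieltjes_null_facts.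

Section skorohod_facts.
Context (R : realType).

Lemma within_continuousP (A : set R) (f : R -> R) : {within A, continuous f} <->
  forall t e, A t -> 0 < e -> exists2 d, 0 < d & forall u, A u ->
    `|u - t| < d -> `|f u - f t| < e.
Proof.
rewrite -[X in X <-> _]/(continuous (f : subspace A -> R)) subspace_continuousP.
split=> [cf t e At e0|H t At].
  have /cvgrPdist_lt /(_ _ e0) := cf t At.
  rewrite near_withinE => -[d d0 H]; exists d => // u Au utd.
  by rewrite distrC; apply: H => //=; rewrite distrC.
apply/cvgrPdist_lt => e e0; rewrite near_withinE.
have [d d0 h] := H t e At e0.
by exists d => //= u utd Au; rewrite distrC; apply: h => //; rewrite distrC.
Qed.

Let ray (t : R) : 0 <= t -> [set` `[0, +oo[] t.
Proof. by rewrite /= in_itv/= andbT. Qed.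

Variables (b : R) (w phi z p : R -> R).
Hypotheses (b0 : 0 < b) (cw : {within `[0, +oo[, continuous w})
  (sk : skorohod 0 b w phi z p).

(** A control whose barrier is not touched at [t] has no atom there. If phi(t) = b, then phi(u) <=
    phi(t), so the increment of [p] is at most that of [w + z], which is small; at the lower barrier
    the roles of [z] and [p] are exchanged. Both barriers cannot be touched at once since b > 0. *)
Lemma skorohod_left (t e : R) : 0 < t -> 0 < e ->
  exists s, [/\ 0 <= s, s < t &
    forall u, s <= u -> u <= t -> z t - z u < e /\ p t - p u < e].
Proof.
have [phiE phib [[_ ndz _] [_ ndp _]] nz np] := sk.
move=> t0 e0; have e20 : 0 < e / 2 by rewrite divr_gt0.
have t0' := ltW t0.
have ein : e / 2 < e by rewrite ltr_pdivrMr// ltr_pMr// ltr1n.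
have [d d0 wd] := (within_continuousP _ _).1 cw t _
  (ray t0') e20.
have wl : exists s, [/\ 0 <= s, s < t &
    forall u, s <= u -> u <= t -> `|w u - w t| < e / 2].
  exists (Num.max 0 (t - d / 2)); split.
  - by rewrite le_max lexx.
  - by rewrite gt_max t0 gtrBl divr_gt0.
  - move=> u; rewrite ge_max => /andP[u0 ud] ut; apply: wd.
      by rewrite /= in_itv/= u0.
    by rewrite ltr_norml; lra.
have [s1 [s10 s1t w1]] := wl.
have phiB u : 0 <= u -> 0 <= phi u <= b.
  by move=> /phib; rewrite in_itv.
have zl : 0 < phi t -> exists s, [/\ 0 <= s, s < t &
    forall u, s <= u -> u <= t -> z t - z u < e / 2].
  move=> pt; apply: (stieltjes_null_left nz) => //=.
  by have := phiB t t0'; rewrite in_itv/= pt => /andP[].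
have pl : phi t < b -> exists s, [/\ 0 <= s, s < t &
    forall u, s <= u -> u <= t -> p t - p u < e / 2].
  move=> pt; apply: (stieltjes_null_left np) => //=.
  by have := phiB t t0'; rewrite in_itv/= pt => /andP[-> _].
have [pt|pt] := ltP 0 (phi t); have [pt'|pt'] := ltP (phi t) b.
- have [s2 [s20 s2t z2]] := zl pt; have [s3 [s30 s3t p3]] := pl pt'.
  exists (Num.max s2 s3); split; [by rewrite le_max s20|by rewrite gt_max s2t|].
  move=> u; rewrite ge_max => /andP[su su'] ut.
  by split; apply: lt_trans ein; [exact: z2|exact: p3].
- have [s2 [s20 s2t z2]] := zl pt.
  exists (Num.max s1 s2); split; [by rewrite le_max s10|by rewrite gt_max s1t|].
  move=> u; rewrite ge_max => /andP[su su'] ut.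
  have u0 : 0 <= u by exact: le_trans su.
  have := z2 _ su' ut; have := w1 _ su ut; rewrite ltr_norml => /andP[h1 h2].
  have := phiB _ u0; have := phiE _ u0; have := phiE _ t0'.
  by move=> e1 e2' /andP[h3 h4] h5; split; lra.
- have [s2 [s20 s2t p2]] := pl pt'.
  exists (Num.max s1 s2); split; [by rewrite le_max s10|by rewrite gt_max s1t|].
  move=> u; rewrite ge_max => /andP[su su'] ut.
  have u0 : 0 <= u by exact: le_trans su.
  have := p2 _ su' ut; have := w1 _ su ut; rewrite ltr_norml => /andP[h1 h2].
  have := phiB _ u0; have := phiE _ u0; have := phiE _ t0'.
  by move=> e1 e2' /andP[h3 h4] h5; split; lra.
- by have := lt_le_trans b0 (le_trans pt' pt); rewrite ltxx.
Qed.

Lemma skorohod_continuous : {within `[0, +oo[, continuous phi}.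
Proof.
have [phiE phib [[[rcz _] ndz _] [[rcp _] ndp _]] nz np] := sk.
apply/within_continuousP => t e; rewrite /= in_itv/= andbT => t0 e0.
have e30 : 0 < e / 3 by rewrite divr_gt0.
have [d d0 wd] := (within_continuousP _ _).1 cw t _
  (ray t0) e30.
have [dr dr0 Hr] : exists2 d, 0 < d & forall u, t < u -> u < t + d ->
    `|z u - z t| < e / 3 /\ `|p u - p t| < e / 3.
  have /cvgrPdist_lt /(_ _ e30) := rcz t t0.
  have /cvgrPdist_lt /(_ _ e30) := rcp t t0.
  rewrite !near_withinE => -[d1 d10 H1] [d2 d20 H2].
  exists (Num.min d1 d2); first by rewrite lt_min d10.
  move=> u tu utd; have h : t - u < 0 by rewrite subr_lt0.
  have ud : `|t - u| < Num.min d1 d2 by rewrite ltr0_norm// opprB ltrBlDl.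
  rewrite lt_min in ud; have /andP[ud1 ud2] := ud.
  by split; rewrite distrC; [apply: H2|apply: H1].
have [dl dl0 Hl] : exists2 d, 0 < d & forall u, 0 <= u -> u < t -> t - d < u ->
    `|z u - z t| < e / 3 /\ `|p u - p t| < e / 3.
  move: t0; rewrite le_eqVlt => /predU1P[<-|t0].
    by exists 1 => // u u0 /(le_lt_trans u0); rewrite ltxx.
  have [s [s0 st H]] := skorohod_left t0 e30.
  exists (t - s); first by rewrite subr_gt0.
  move=> u u0 ut; rewrite opprB addrC subrK => su.
  have [h1 h2] := H u (ltW su) (ltW ut).
  have uI : u \in `[0, +oo[ by rewrite in_itv/= u0.
  have tI : t \in `[0, +oo[ by rewrite in_itv/= ltW.
  have h3 := ndz _ _ uI tI (ltW ut); have h4 := ndp _ _ uI tI (ltW ut).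
  by rewrite !ltr_norml; lra.
exists (Num.min d (Num.min dr dl)); first by rewrite !lt_min d0 dr0.
move=> u; rewrite in_itv/= andbT => u0; rewrite !lt_min => /and3P[ud udr udl].
have := wd u; rewrite /= in_itv/= u0 => /(_ isT ud).
rewrite (phiE _ u0) (phiE _ t0).
have [->|ut] := eqVneq u t; first by move=> _; rewrite subrr normr0.
have [h1 h2] : `|z u - z t| < e / 3 /\ `|p u - p t| < e / 3.
  have [tu|tu] := ltP t u.
    by apply: Hr => //; move: udr; rewrite ltr_norml; lra.
  have {tu}ut : u < t by rewrite lt_neqAle ut.
  by apply: Hl => //; move: udl; rewrite ltr_norml; lra.
by move: h1 h2; rewrite !ltr_norml; lra.
Qed.

End skorohod_facts.

(** * Verification *)

Section real_line.
Context (R : realType).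

Lemma real_induction (T : R) (P : R -> Prop) : 0 <= T -> P 0 ->
  (forall t, 0 <= t -> t < T -> P t ->
    exists2 d, 0 < d & forall u, t <= u -> u <= t + d -> u <= T -> P u) ->
  (forall t, 0 < t -> t <= T -> (forall u, 0 <= u -> u < t -> P u) -> P t) ->
  P T.
Proof.
move=> T0 P0 right left.
pose S := [set t | 0 <= t <= T /\ forall u, 0 <= u -> u <= t -> P u].
have S0 : S 0.
  split; first by rewrite lexx.
  by move=> u u0 u0'; have -> : u = 0 by apply/eqP; rewrite eq_le u0 u0'.
have supS : has_sup S by split; [exists 0|exists T => t [/andP[]]].
pose a := sup S.
have a0 : 0 <= a by apply: ub_le_sup => //; case: supS.
have aT : a <= T by apply: ge_sup; [exists 0|move=> t [/andP[]]].
have Pl u : 0 <= u -> u < a -> P u.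
  move=> u0 ua; have [t [_ tP] ut] := sup_gt (ex_intro _ 0 S0) ua.
  by apply: tP => //; exact: ltW.
have Pa : P a.
  by move: a0; rewrite le_eqVlt => /predU1P[<-//|a0]; exact: left.
have Sa : S a.
  split; first by rewrite a0.
  by move=> u u0; rewrite le_eqVlt => /predU1P[->//|]; exact: Pl.
have [/eqP aT'|aT'] := boolP (a == T); first by rewrite -aT'.
have {}aT' : a < T by rewrite lt_neqAle aT'.
have [d d0 H] := right a a0 aT' Pa.
pose m := Num.min (a + d) T.
have am : a < m by rewrite lt_min ltrDl d0.
have Sm : S m.
  split.
    by rewrite (le_trans a0 (ltW am))/= ge_min lexx orbT.
  move=> u u0 um; have [au|ua] := leP a u; last exact: Pl.
  by move: um; rewrite le_min => /andP[]; exact: H.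
by have := ub_le_sup supS.2 Sm; rewrite leNgt am.
Qed.

Lemma distr_between (u v x z n : R) : Num.min u v <= x -> x <= Num.max u v ->
  `|u - z| < n -> `|v - z| < n -> `|x - z| < n.
Proof.
rewrite !ltr_norml ge_min le_max => xm xM /andP[u1 u2] /andP[v1 v2].
apply/andP; split; [case/orP: xm => ?|case/orP: xM => ?]; lra.
Qed.

(** The supremum of the times with q >= 0 is itself such a time, by continuity. With q = - phi or q
    = phi - b it is the last visit to a barrier. *)
Lemma last_nonneg (q : R -> R) (s t : R) : s <= t ->
  (forall a, s <= a -> a <= t -> forall e, 0 < e -> exists2 d, 0 < d &
    forall u, s <= u -> u <= t -> `|u - a| < d -> `|q u - q a| < e) ->
  0 <= q s ->
  exists a, [/\ s <= a, a <= t, 0 <= q a & forall u, a < u -> u <= t -> q u < 0].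
Proof.
move=> st cq qs.
pose S := [set u | s <= u <= t /\ 0 <= q u].
have S0 : S s by split; rewrite ?lexx.
have supS : has_sup S by split; [exists s|exists t => u [/andP[]]].
pose a := sup S.
have sa : s <= a by apply: ub_le_sup => //; case: supS.
have at' : a <= t by apply: ge_sup; [exists s|move=> u [/andP[]]].
exists a; split => //.
  rewrite leNgt; apply/negP => qa.
  have nqa : 0 < - q a by rewrite oppr_gt0.
  have [d d0 H] := cq a sa at' _ nqa.
  have [u [/andP[su ut] qu] au] := sup_adherent d0 supS.
  have ua : u <= a by apply: ub_le_sup; [case: supS|split; rewrite ?su].
  rewrite -/a in au.
  have : `|u - a| < d by rewrite ltr_norml; lra.
  by move=> /(H u su ut); rewrite ltr_norml; lra.
move=> u au ut; rewrite ltNge; apply/negP => qu.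
have : S u by split; rewrite ?ut ?(le_trans sa (ltW au)).
by move=> /(ub_le_sup supS.2); rewrite leNgt au.
Qed.

End real_line.

Section verification.
Context (R : realType).
(** The argument uses only inequalities between increments, so the data are abstract: [w] is the
    free path, [z] and [p] the upward and downward controls, [E] and [Q] the energy and running cost
    accumulated so far, and [k] stands for the derivative of [G]. [energy_le] is the integrated
    Young inequality; [G_le] and [G_ge] replace differentiability of [G]. *)
Variables (T b c r y : R) (w phi z p E Q h k G : R -> R).
Hypotheses (T0 : 0 <= T) (b0 : 0 < b) (c0 : 0 < c) (r0 : 0 < r).
Hypothesis phiE : forall t, 0 <= t -> t <= T -> phi t = w t + z t - p t.
Hypothesis phib : forall t, 0 <= t -> t <= T -> 0 <= phi t <= b.
Hypothesis phi_cont : forall t, 0 <= t -> t <= T -> forall e, 0 < e ->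
  exists2 d, 0 < d & forall u, 0 <= u -> u <= T -> `|u - t| < d ->
    `|phi u - phi t| < e.
Hypothesis z_cst : forall s t, 0 <= s -> s <= t -> t <= T ->
  (forall u, s < u -> u <= t -> 0 < phi u) -> z t = z s.
Hypothesis p_cst : forall s t, 0 <= s -> s <= t -> t <= T ->
  (forall u, s < u -> u <= t -> phi u < b) -> p t = p s.
Hypothesis p_left : forall t e, 0 < t -> t <= T -> 0 < e ->
  exists s, [/\ 0 <= s, s < t & forall u, s <= u -> u <= t -> p t - p u < e].
Hypothesis energy_le : forall q s t, 0 <= s -> s <= t -> t <= T ->
  q * (w t - w s) <= E t - E s + (q ^+ 2 / (4 * c) + q * y) * (t - s).
Hypothesis Q_le : forall M s t, 0 <= s -> s <= t -> t <= T ->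
  (forall u, s <= u -> u <= t -> h (phi u) <= M) -> Q t - Q s <= M * (t - s).
Hypothesis G_le : forall M u v, 0 <= u -> u <= v -> v <= b ->
  (forall x, u <= x -> x <= v -> k x <= M) -> G v - G u <= M * (v - u).
Hypothesis G_ge : forall M u v, 0 <= u -> u <= v -> v <= b ->
  (forall x, u <= x -> x <= v -> M <= k x) -> M * (v - u) <= G v - G u.
Hypothesis hk_cont : forall x, 0 <= x -> x <= b -> forall e, 0 < e ->
  exists2 d, 0 < d & forall x', 0 <= x' -> x' <= b -> `|x' - x| < d ->
    `|k x' - k x| < e /\ `|h x' - h x| < e.
Hypothesis k0 : k 0 = 0.
Hypothesis kr : forall x, 0 <= x -> x <= b -> 0 <= k x <= r.
Hypothesis hjb : forall x, 0 <= x -> x <= b ->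
  k x ^+ 2 / (4 * c) + y * k x + h x <= 0.
Hypothesis hjb_r : r ^+ 2 / (4 * c) + y * r + h b <= 0.

Let M t := Q t + r * p t - E t + G (phi t).
(** A bound for q^2/(4c) + q y at q = 1 and q = -1, the two slopes that control the absolute
    increment of [w]. *)
Let C := 1 / (4 * c) + `|y|.

Let C0 : 0 <= C.
Proof. by rewrite addr_ge0// divr_ge0// mulr_ge0// ltW. Qed.

Let E_nd s t : 0 <= s -> s <= t -> t <= T -> E s <= E t.
Proof.
move=> s0 st tT; have := energy_le 0 s0 st tT.
by rewrite !mul0r expr0n/= mul0r addr0 mul0r addr0 subr_ge0.
Qed.

Let normw s t : 0 <= s -> s <= t -> t <= T ->
  `|w t - w s| <= E t - E s + C * (t - s).
Proof.
move=> s0 st tT; rewrite ler_norml; apply/andP; split.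
  rewrite lerNl; have := energy_le (-1) s0 st tT; rewrite mulN1r => /le_trans.
  apply; rewrite lerD2l ler_wpM2r ?subr_ge0// /C sqrrN expr1n lerD2l mulN1r.
  by rewrite -normrN ler_norm.
have := energy_le 1 s0 st tT; rewrite mul1r => /le_trans; apply.
by rewrite lerD2l ler_wpM2r ?subr_ge0// /C expr1n lerD2l mul1r ler_norm.
Qed.

Let G_lip u v L e : 0 <= u -> u <= b -> 0 <= v -> v <= b ->
  (forall x, Num.min u v <= x -> x <= Num.max u v -> L - e <= k x <= L + e) ->
  G v - G u <= L * (v - u) + e * `|v - u|.
Proof.
move=> u0 ub v0 vb H; have [uv|vu] := leP u v.
  rewrite ger0_norm ?subr_ge0// -mulrDl; apply: G_le => // x ux xv.
  by have := H x; rewrite min_l// max_r// => /(_ ux xv)/andP[].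
rewrite ltr0_norm ?subr_lt0//.
have -> : L * (v - u) + e * - (v - u) = - ((L - e) * (u - v)) by ring.
rewrite lerNr opprB; apply: G_ge => //; first exact: ltW.
move=> x vx xu; have := H x; rewrite min_r ?max_l//; [|exact: ltW..].
by move=> /(_ vx xu)/andP[].
Qed.

(* Starting from a time when phi is at a barrier, the pushing stops after the
   last visit [a] to the barrier; between [t0] and [a] only the value at the
   barrier matters. *)
Let barrier_step t0 t e n : 0 <= t0 -> t0 <= t -> t <= T -> 0 < n -> n <= b ->
  (0 < phi t0 -> phi t0 < b -> n <= phi t0 /\ n <= b - phi t0) ->
  (forall u, t0 <= u -> u <= t -> `|phi u - phi t0| < n) ->
  (forall u, t0 <= u -> u <= t -> h (phi u) <= h (phi t0) + e) ->
  exists a, [/\ t0 <= a, a <= t, M a - M t0 <= e * (a - t0),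
    z t = z a & p t = p a].
Proof.
move=> t00 t0t tT n0 nb nphi phin he.
have hphi u : t0 <= u -> u <= t -> 0 <= phi u <= b.
  by move=> tu ut; apply: phib; rewrite ?(le_trans t00)// (le_trans ut).
have /andP[p0 pb] := hphi _ (lexx _) t0t.
have phic a : t0 <= a -> a <= t -> forall e, 0 < e -> exists2 d, 0 < d &
    forall u, t0 <= u -> u <= t -> `|u - a| < d -> `|phi u - phi a| < e.
  move=> ta a_t e' e'0.
  have [d d0 H] := phi_cont (le_trans t00 ta) (le_trans a_t tT) e'0.
  exists d => // u tu ut; apply: H; first exact: le_trans tu.
  exact: le_trans tT.
have [pz|pz] := leP (phi t0) 0.
  have {pz}pz : phi t0 = 0 by apply/eqP; rewrite eq_le pz p0.
  have phin' u : t0 <= u -> u <= t -> phi u < b.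
    move=> tu ut; apply: lt_le_trans nb.
    by have := phin u tu ut; rewrite pz subr0; apply: le_lt_trans; exact: ler_norm.
  have [||a [ta a_t qa aq]] := @last_nonneg _ (fun u => - phi u) t0 t t0t.
  - move=> a ta a_t e' e0; have [d d0 H] := phic a ta a_t _ e0.
    exists d => // u tu ut ud; rewrite -opprD normrN; exact: H.
  - by rewrite pz oppr0.
  have pa : phi a = 0.
    by apply/eqP; rewrite eq_le -oppr_ge0 qa; have /andP[] := hphi a ta a_t.
  have aT : a <= T by exact: le_trans tT.
  have a0 : 0 <= a by exact: le_trans ta.
  exists a; split => //.
  (* Both ends lie at the lower barrier and [p] is constant, so [M] changes only by running cost
     minus energy, and h(0) <= 0 by [hjb] at 0, where [k] vanishes. *)
  - rewrite /M pa pz; have -> : p a = p t0.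
      by apply: p_cst => // u tu ua; apply: phin'; [exact: ltW|exact: le_trans a_t].
    have := @E_nd t0 a t00 ta aT.
    have : Q a - Q t0 <= (h (phi t0) + e) * (a - t0).
      by apply: Q_le => // u tu ua; apply: he => //; exact: le_trans a_t.
    have h0 : h (phi t0) <= 0.
      by have := hjb (lexx 0) (ltW b0); rewrite k0 pz expr0n/= mul0r mulr0 !add0r.
    have : h (phi t0) * (a - t0) <= 0 by rewrite mulr_le0_ge0// subr_ge0.
    by rewrite mulrDl; lra.
  - by apply: z_cst => // u au ut; rewrite -oppr_lt0 aq.
  - apply: p_cst => // u au ut; apply: phin' => //.
    by rewrite (le_trans ta)// ltW.
have [pb'|pb'] := leP b (phi t0).
  have {pb'}pb' : phi t0 = b by apply/eqP; rewrite eq_le pb pb'.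
  have phin' u : t0 <= u -> u <= t -> 0 < phi u.
    by move=> tu ut; have := phin u tu ut; rewrite pb' ltr_norml; lra.
  have [||a [ta a_t qa aq]] := @last_nonneg _ (fun u => phi u - b) t0 t t0t.
  - move=> a ta a_t e' e0; have [d d0 H] := phic a ta a_t _ e0.
    exists d => // u tu ut ud.
    have -> : phi u - b - (phi a - b) = phi u - phi a by ring.
    exact: H.
  - by rewrite pb' subrr.
  have pa : phi a = b.
    apply/eqP; rewrite eq_le -[b <= _]subr_ge0 qa.
    by have /andP[_ ->] := hphi a ta a_t.
  have aT : a <= T by exact: le_trans tT.
  have a0 : 0 <= a by exact: le_trans ta.
  have t0T : t0 <= T by exact: le_trans tT.
  exists a; split => //.
  - rewrite /M pa pb'; have za : z a = z t0.
      by apply: z_cst => // u tu ua; apply: phin'; [exact: ltW|exact: le_trans a_t].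
    have : Q a - Q t0 <= (h (phi t0) + e) * (a - t0).
      by apply: Q_le => // u tu ua; apply: he => //; exact: le_trans a_t.
    (* With both ends at [b] and [z] constant, the amount pushed down is the increment of the free
       path; charging it at price [r] is [energy_le] with slope [r]. *)
    have pp : p a - p t0 = w a - w t0.
      by have := phiE a0 aT; have := phiE t00 t0T; rewrite pa pb' za; lra.
    have := @energy_le r t0 a t00 ta aT; rewrite -pp.
    have : (r ^+ 2 / (4 * c) + y * r + h b) * (a - t0) <= 0.
      by rewrite mulr_le0_ge0// subr_ge0.
    by rewrite pb' !mulrDl; lra.
  - apply: z_cst => // u au ut; apply: phin' => //.
    by rewrite (le_trans ta)// ltW.
  - by apply: p_cst => // u au ut; rewrite -subr_lt0 aq.
have [np nb'] := nphi pz pb'.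
exists t0; split => //; first by rewrite !subrr mulr0.
- apply: z_cst => // u tu ut.
  by have := phin u (ltW tu) ut; rewrite ltr_norml; lra.
- apply: p_cst => // u tu ut.
  by have := phin u (ltW tu) ut; rewrite ltr_norml; lra.
Qed.

Let right_step t0 e : 0 <= t0 -> t0 < T -> 0 < e ->
  exists2 d, 0 < d & forall t, t0 <= t -> t <= t0 + d -> t <= T ->
    M t - M t0 <= e * (E t - E t0 + (C + 1) * (t - t0)).
Proof.
move=> t00 t0T e0; have /andP[p0 pb] := phib t00 (ltW t0T).
have [n n0 Hn] := hk_cont p0 pb e0.
(* In the interior, [m] is the distance to the nearer barrier, so that neither is reached; at a
   barrier, [b] keeps the path off the opposite one. *)
pose m := if (0 < phi t0) && (phi t0 < b) then
  Num.min (phi t0) (b - phi t0) else b.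
have m0 : 0 < m.
  rewrite /m; case: ifPn => // /andP[h1 h2].
  by rewrite lt_min h1 subr_gt0.
pose n' := Num.min n (Num.min b m).
have n'0 : 0 < n' by rewrite !lt_min n0 b0.
have [d d0 Hd] := phi_cont t00 (ltW t0T) n'0.
exists (d / 2); first by rewrite divr_gt0.
move=> t tt td tT.
have phin u : t0 <= u -> u <= t -> `|phi u - phi t0| < n'.
  move=> tu ut; apply: Hd; first exact: le_trans tu.
    exact: le_trans tT.
  by rewrite ger0_norm ?subr_ge0//; lra.
have hphi u : t0 <= u -> u <= t -> 0 <= phi u <= b.
  by move=> tu ut; apply: phib; rewrite ?(le_trans t00)// (le_trans ut).
have khn x : 0 <= x -> x <= b -> `|x - phi t0| < n' ->
    `|k x - k (phi t0)| < e /\ `|h x - h (phi t0)| < e.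
  by move=> x0 xb; rewrite lt_min => /andP[xn _]; exact: Hn.
have he u : t0 <= u -> u <= t -> h (phi u) <= h (phi t0) + e.
  move=> tu ut; have /andP[h1 h2] := hphi u tu ut.
  by have [_] := khn _ h1 h2 (phin u tu ut); rewrite ltr_norml; lra.
have [a [ta a_t Ma za pa]] : exists a, [/\ t0 <= a, a <= t,
    M a - M t0 <= e * (a - t0), z t = z a & p t = p a].
  apply: (@barrier_step t0 t e n') => //.
    by rewrite /n' !ge_min lexx orbT.
  move=> h1 h2; rewrite /n' /m h1 h2/= !ge_min !lexx !orbT; split => //.
have a0 : 0 <= a by exact: le_trans ta.
have aT : a <= T by exact: le_trans tT.
have t0' : 0 <= t by exact: le_trans a_t.
have /andP[pa0 pab] := hphi a ta a_t; have /andP[pt0 ptb] := hphi t tt (lexx _).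
have wE : phi t - phi a = w t - w a.
  by rewrite (phiE a0 aT) (phiE t0' tT) za pa; ring.
have step2 : M t - M a <= e * (E t - E a + (C + 1) * (t - a)).
  set K := k (phi t0); set H := h (phi t0).
  have g1 : G (phi t) - G (phi a) <= K * (phi t - phi a) + e * `|phi t - phi a|.
    apply: G_lip => // x xm xM.
    have x0 : 0 <= x by apply: le_trans xm; rewrite le_min pa0.
    have xb : x <= b by rewrite (le_trans xM)// ge_max pab.
    have [|+ _] := khn x x0 xb.
      exact: distr_between xm xM (phin a ta a_t) (phin t tt (lexx _)).
    by rewrite ltr_norml /K; lra.
  have q1 : Q t - Q a <= (H + e) * (t - a).
    by apply: Q_le => // u au ut; apply: he => //; exact: le_trans au.
  have e1 := @energy_le K a t a0 a_t tT.
  have w1 := @normw a t a0 a_t tT.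
  have j1 : (K ^+ 2 / (4 * c) + y * K + H) * (t - a) <= 0.
    by rewrite mulr_le0_ge0// ?subr_ge0// hjb.
  have w2 : e * `|w t - w a| <= e * (E t - E a + C * (t - a)).
    by rewrite ler_pM2l.
  rewrite wE in g1; rewrite /M pa; lra.
have Et := @E_nd t0 a t00 ta aT.
have h1 : 0 <= e * (E a - E t0) by rewrite mulr_ge0 ?subr_ge0// ltW.
have h2 : 0 <= e * C * (a - t0) by rewrite !mulr_ge0 ?subr_ge0// ltW.
by move: Ma step2 h1 h2; lra.
Qed.

Lemma verification : Q T + r * p T - E T + G (phi T) <=
  Q 0 + r * p 0 - E 0 + G (phi 0).
Proof.
rewrite -/(M T) -/(M 0).
pose K t := E t - E 0 + (C + 1) * t.
have K0 : 0 <= K T.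
  by rewrite /K addr_ge0 ?subr_ge0 ?E_nd// mulr_ge0// addr_ge0.
apply/ler_addgt0Pr => e' e'0.
(* Chosen so that the total error [e * K T] is at most [e']; the summand 1 keeps the denominator
   positive. *)
pose e := e' / (K T + 1).
have e0 : 0 < e by rewrite divr_gt0// ltr_wpDl.
suff : M T <= M 0 + e * K T.
  move=> /le_trans; apply; rewrite lerD2l /e mulrAC ler_pdivrMr ?ltr_wpDl//.
  by rewrite ler_pM2l// lerDl.
apply: (@real_induction _ T (fun t => M t <= M 0 + e * K t)) => //.
- by rewrite /K subrr mulr0 addr0 mulr0 addr0.
- move=> t t0 tT Mt; have [d d0 H] := right_step t0 tT e0.
  exists d => // u tu ud uT; have := H u tu ud uT.
  move: Mt; rewrite /K; rewrite !mulrDr !mulrDl !mulrDr; lra.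
- move=> t t0 tT IH; apply/ler_addgt0Pr => d d0.
  (* Passage to a left limit. [N] bounds [h] along the path, by [hjb] and 0 <= k <= r; in [d'] the
     term [N] pays for the running cost and [2 * r] for the increments of [p] and [G]. The energy
     enters with a favourable sign. *)
  pose N := r * `|y|.
  have N0 : 0 <= N by rewrite mulr_ge0// ltW.
  pose d' := d / (N + 2 * r + 1).
  have cc : 0 < N + 2 * r + 1 by rewrite ltr_wpDl// addr_ge0// mulr_ge0// ltW.
  have d'0 : 0 < d' by rewrite divr_gt0.
  have [s [s0 st ps]] := p_left t0 tT d'0.
  have [d1 d10 Hd] := phi_cont (ltW t0) tT d'0.
  pose u := Num.max s (t - Num.min d' d1 / 2).
  have min0 : 0 < Num.min d' d1 by rewrite lt_min d'0.
  have ut : u < t by rewrite /u gt_max st gtrBl divr_gt0.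
  have u0 : 0 <= u by rewrite /u le_max s0.
  have uT : u <= T by rewrite (le_trans (ltW ut)).
  have tu : t - u < Num.min d' d1.
    apply: (@le_lt_trans _ _ (Num.min d' d1 / 2)).
      by rewrite lerBlDr -lerBlDl /u le_max lexx orbT.
    by rewrite ltr_pdivrMr// ltr_pMr// ltr1n.
  rewrite lt_min in tu; have /andP[tu1 tu2] := tu.
  have pu : p t - p u < d' by apply: ps => //; [rewrite /u le_max lexx|exact: ltW].
  have phiu : `|phi u - phi t| < d'.
    by apply: Hd => //; rewrite distrC gtr0_norm ?subr_gt0.
  have Eu := @E_nd u t u0 (ltW ut) tT.
  have /andP[pu0 pub] := phib u0 uT; have /andP[pt0 ptb] := phib (ltW t0) tT.
  have Gu : G (phi t) - G (phi u) <= r * `|phi t - phi u|.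
    apply: le_trans (@G_lip _ _ 0 r pu0 pub pt0 ptb _) _; last by rewrite mul0r add0r.
    move=> x xm xM; rewrite sub0r add0r.
    have /andP[kx0 ->] : 0 <= k x <= r.
      apply: kr; first by apply: le_trans xm; rewrite le_min pu0.
      by rewrite (le_trans xM)// ge_max pub.
    by rewrite andbT (le_trans _ kx0)// oppr_le0 ltW.
  have Qu : Q t - Q u <= N * (t - u).
    apply: Q_le => //; first exact: ltW.
    move=> v uv vt; have /andP[v0 vb] : 0 <= phi v <= b.
      by apply: phib; [exact: le_trans uv|exact: le_trans tT].
    have /andP[k1 k2] := kr v0 vb.
    have h1 := hjb v0 vb.
    have h2 : 0 <= k (phi v) ^+ 2 / (4 * c).
      by rewrite divr_ge0 ?sqr_ge0// mulr_ge0// ltW.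
    have h3 : - (y * k (phi v)) <= N.
      rewrite /N -mulNr mulrC; apply: (@le_trans _ _ (k (phi v) * `|y|)).
        by rewrite ler_wpM2l// -normrN ler_norm.
      by rewrite ler_wpM2r.
    lra.
  have := IH u u0 ut.
  have h1 : N * (t - u) <= N * d' by rewrite ler_wpM2l// ltW.
  have h2 : r * (p t - p u) <= r * d' by rewrite ler_pM2l// ltW.
  have h3 : r * `|phi t - phi u| <= r * d' by rewrite ler_pM2l// distrC ltW.
  have h4 : (N + 2 * r) * d' <= d.
    rewrite /d' mulrCA ler_piMr ?ltW// ltr_pdivrMr// mul1r ltrDl//.
  have h5 : e * K u <= e * K t.
    have : 0 <= (C + 1) * (t - u).
      by apply: mulr_ge0; [exact: addr_ge0|rewrite subr_ge0 ltW].
    by rewrite ler_pM2l// /K; lra.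
  by rewrite /M; lra.
Qed.

End verification.

(** * The Hamilton-Jacobi equation *)

Section hamilton_jacobi.
Context (R : realType).

(** The smaller root q of q^2/(4c) + y q + eta = 0; at eta = h(u) it is the integrand of [gint]. *)
Definition hroot (c y eta : R) : R := 2 * c * (- y - Num.sqrt (y ^+ 2 - eta / c)).

Section algebra.
Variables (c y r eta : R).
Hypotheses (c0 : 0 < c) (r0 : 0 < r) (ry : r / (4 * c) <= - y).
Hypotheses (eta0 : 0 <= eta) (etar : r ^+ 2 / (4 * c) + r * y + eta <= 0).

Let cN0 : c != 0. Proof. by rewrite gt_eqF. Qed.

(** Completing the square in r^2/(4c) + r y + eta <= 0 after division by c. *)
Lemma discriminant_ge : (y + r / (2 * c)) ^+ 2 <= y ^+ 2 - eta / c.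
Proof.
have : (r ^+ 2 / (4 * c) + r * y + eta) / c <= 0 by rewrite pmulr_lle0// invr_gt0.
have -> : (r ^+ 2 / (4 * c) + r * y + eta) / c =
  (y + r / (2 * c)) ^+ 2 - (y ^+ 2 - eta / c) by field.
by rewrite subr_le0.
Qed.

Lemma discriminant_ge0 : 0 <= y ^+ 2 - eta / c.
Proof. exact: le_trans (sqr_ge0 _) discriminant_ge. Qed.

Lemma hroot_hjb : hroot c y eta ^+ 2 / (4 * c) + y * hroot c y eta + eta = 0.
Proof.
have := sqr_sqrtr discriminant_ge0; rewrite /hroot.
set s := Num.sqrt _ => sE.
have -> : eta = c * (y ^+ 2 - s ^+ 2) by rewrite sE; field.
by field.
Qed.

Lemma hroot_ge0 : 0 <= hroot c y eta.
Proof.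
have y0 : 0 <= - y by apply: le_trans ry; rewrite divr_ge0 ?mulr_ge0// ltW.
rewrite /hroot; apply: mulr_ge0; [by rewrite mulr_ge0// ltW|rewrite subr_ge0].
rewrite -(ger0_norm y0) normrN -sqrtr_sqr; apply: ler_wsqrtr.
by rewrite gerBl divr_ge0// ltW.
Qed.

Lemma hroot_le : hroot c y eta <= r.
Proof.
have : - (y + r / (2 * c)) <= Num.sqrt (y ^+ 2 - eta / c).
  apply: (le_trans (ler_norm _)); rewrite normrN -sqrtr_sqr.
  exact/ler_wsqrtr/discriminant_ge.
rewrite /hroot; set s := Num.sqrt _ => h.
have -> : r = 2 * c * (r / (2 * c)) by field.
by rewrite ler_pM2l ?mulr_gt0//; lra.
Qed.

End algebra.

Lemma hroot0 c y : y <= 0 -> hroot c y 0 = 0.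
Proof.
move=> y0; rewrite /hroot mul0r subr0 sqrtr_sqr ler0_norm//.
by rewrite subrr mulr0.
Qed.

(** In the first branch the last inequality is an equality: the intermediate value theorem supplies
    a preimage and injectivity makes [pinv] return it. In the second it is the negated test. *)
Lemma beta0_itv (D r c y : R) (h : R -> R) : 0 < D -> 0 < c -> 0 < r ->
  {within `[0, D], continuous h} -> {in `[0, D] &, {homo h : u v / u < v}} ->
  h 0 = 0 -> r / (4 * c) <= - y ->
  [/\ 0 <= beta0 D r c y h, beta0 D r c y h <= D &
      r ^+ 2 / (4 * c) + r * y + h (beta0 D r c y h) <= 0].
Proof.
move=> D0 c0 r0 ch ih h0 ry.
have v0 : r ^+ 2 / (4 * c) + r * y <= 0.
  have -> : r ^+ 2 / (4 * c) + r * y = r * (r / (4 * c) + y) by field; rewrite gt_eqF.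
  by rewrite pmulr_rle0//; lra.
rewrite /beta0; case: ifPn => [hv|]; last first.
  by rewrite -ltNge => hv; rewrite lexx ltW//; split => //; lra.
have inj : {in [set` `[0, D]] &, injective h}.
  move=> u v /set_mem uD /set_mem vD huv.
  case: (ltgtP u v) => // uv.
    by have := ih _ _ uD vD uv; rewrite huv ltxx.
  by have := ih _ _ vD uD uv; rewrite huv ltxx.
have hD : 0 < h D by rewrite -h0; apply: ih; rewrite // in_itv/= lexx ltW.
have [|z zD hz] := @IVT _ h 0 D (- (r ^+ 2 / (4 * c)) - r * y) (ltW D0) ch.
  by rewrite h0 (min_l (ltW hD)) (max_r (ltW hD)); apply/andP; split; lra.
rewrite -hz pinvKV//; last exact: mem_set.
move: zD; rewrite in_itv/= => /andP[-> ->]; split => //.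
by rewrite hz; lra.
Qed.

Lemma continuous_itv_integrable (f : R -> R) (a b : R) :
  {within `[a, b], continuous f} ->
  (@lebesgue_measure R).-integrable `[a, b] (EFin \o f).
Proof.
by move=> cf; apply: continuous_compact_integrable => //; exact: segment_compact.
Qed.

Lemma Rintegral_itv_le (f : R -> R) (a b M u v : R) :
  (@lebesgue_measure R).-integrable `[a, b] (EFin \o f) ->
  a <= u -> u <= v -> v <= b -> (forall x, u <= x -> x <= v -> f x <= M) ->
  \int[lebesgue_measure]_(x in `[a, v]) f x -
  \int[lebesgue_measure]_(x in `[a, u]) f x <= M * (v - u).
Proof.
move=> fi au uv vb fM.
have iav : (@lebesgue_measure R).-integrable `[a, v] (EFin \o f).
  by apply: integrableS fi => //; apply: subset_itvl; rewrite bnd_simp.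
rewrite Rintegral_itvB ?bnd_simp//.
have -> : M * (v - u) = \int[lebesgue_measure]_(x in `]u, v]) M.
  rewrite Rintegral_cst//= lebesgue_measure_itv/= lte_fin.
  by case: ltP => // vu; rewrite (le_anti (_ : u <= v <= u)) ?uv//= subrr mulr0.
apply: le_Rintegral => //.
- by apply: integrableS iav => //; apply: subset_itvr; rewrite bnd_simp.
- have : (@lebesgue_measure R).-integrable `[u, v] (EFin \o (fun=> M)).
    by apply: continuous_itv_integrable => x; exact: cvg_cst.
  by apply: integrableS => //; exact: subset_itv_oc_cc.
- move=> x; rewrite /= in_itv/= => /andP[ux xv]; apply: fM => //.
  exact: ltW.
Qed.

Lemma Rintegral_itv_ge (f : R -> R) (a b M u v : R) :
  (@lebesgue_measure R).-integrable `[a, b] (EFin \o f) ->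
  a <= u -> u <= v -> v <= b -> (forall x, u <= x -> x <= v -> M <= f x) ->
  M * (v - u) <= \int[lebesgue_measure]_(x in `[a, v]) f x -
  \int[lebesgue_measure]_(x in `[a, u]) f x.
Proof.
move=> fi au uv vb fM.
have iav : (@lebesgue_measure R).-integrable `[a, v] (EFin \o f).
  by apply: integrableS fi => //; apply: subset_itvl; rewrite bnd_simp.
rewrite Rintegral_itvB ?bnd_simp//.
have -> : M * (v - u) = \int[lebesgue_measure]_(x in `]u, v]) M.
  rewrite Rintegral_cst//= lebesgue_measure_itv/= lte_fin.
  by case: ltP => // vu; rewrite (le_anti (_ : u <= v <= u)) ?uv//= subrr mulr0.
apply: le_Rintegral => //.
- have : (@lebesgue_measure R).-integrable `[u, v] (EFin \o (fun=> M)).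
    by apply: continuous_itv_integrable => x; exact: cvg_cst.
  by apply: integrableS => //; exact: subset_itv_oc_cc.
- by apply: integrableS iav => //; apply: subset_itvr; rewrite bnd_simp.
- move=> x; rewrite /= in_itv/= => /andP[ux xv]; apply: fM => //.
  exact: ltW.
Qed.

Lemma hroot_continuous (c y : R) (A : set R) (h : R -> R) :
  {within A, continuous h} -> {within A, continuous (fun x => hroot c y (h x))}.
Proof.
move=> ch x; apply: cvgM; first exact: cvg_cst.
apply: cvgB; first exact: cvg_cst.
apply: continuous_comp; last exact: sqrt_continuous.
apply: cvgB; first exact: cvg_cst.
by apply: cvgM; [exact: ch|exact: cvg_cst].
Qed.

End hamilton_jacobi.

(** * Energy of a disturbance *)

Section energies.
Context (R : realType).
Notation mu := (@lebesgue_measure R).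
Variables (c1 c2 : R).
Hypotheses (c10 : 0 < c1) (c20 : 0 < c2).
Notation c := (cpar c1 c2).

Lemma cpar_gt0 : 0 < c.
Proof. by rewrite /cpar invr_gt0 addr_gt0// invr_gt0. Qed.

(** Squares are completed in [a] and [b] separately; their constants q^2/(4 c1) and q^2/(4 c2) add
    up to q^2/(4c), the origin of the harmonic combination [cpar]. *)
Lemma energy_young (q a b : R) :
  - (q ^+ 2 / (4 * c)) <= c1 * a ^+ 2 + c2 * b ^+ 2 - q * (a - b).
Proof.
have c1N : c1 != 0 by rewrite gt_eqF.
have c2N : c2 != 0 by rewrite gt_eqF.
rewrite -subr_ge0 /cpar.
have -> : c1 * a ^+ 2 + c2 * b ^+ 2 - q * (a - b) -
    - (q ^+ 2 / (4 * (c1^-1 + c2^-1)^-1)) =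
    c1 * (a - q / (2 * c1)) ^+ 2 + c2 * (b + q / (2 * c2)) ^+ 2.
  rewrite invfM invrK; field; rewrite ?c1N ?c2N//.
by rewrite addr_ge0// mulr_ge0 ?sqr_ge0// ltW.
Qed.

Variables (T : R) (psi : (R -> R) * (R -> R)).
Hypothesis T0 : 0 <= T.

Lemma energy_density : abs_continuous_on 0 T psi.1 -> abs_continuous_on 0 T psi.2 ->
  exists d1 d2 : R -> R, [/\ mu.-integrable setT (EFin \o d1),
    mu.-integrable setT (EFin \o d2),
    (forall t, t \in `[0, T] -> psi.1 t - psi.1 0 = \int[mu]_(s in `[0, t]) d1 s /\
                psi.2 t - psi.2 0 = \int[mu]_(s in `[0, t]) d2 s),
    {ae mu, forall s, s \in `[0, T] ->
      (psi.1)^`()%classic s = d1 s /\ (psi.2)^`()%classic s = d2 s} &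
    energy c1 c2 T psi =
      (\int[mu]_(s in `[0%R, T]) (c1 * d1 s ^+ 2 + c2 * d2 s ^+ 2)%:E)%E].
Proof.
move=> ac1 ac2.
have [d1 [i1 E1 D1]] := abs_continuous_density T0 ac1.
have [d2 [i2 E2 D2]] := abs_continuous_density T0 ac2.
have D12 : {ae mu, forall s, s \in `[0, T] ->
      (psi.1)^`()%classic s = d1 s /\ (psi.2)^`()%classic s = d2 s}.
  apply: filterS2 D1 D2; first exact: (ae_filter_ringOfSetsType mu).
  by move=> s h1 h2 sT; split; [exact: h1|exact: h2].
exists d1, d2; split => //; first by move=> t tT; split; [exact: E1|exact: E2].
rewrite /energy asboolT//.
have md1 : measurable_fun setT d1 by apply/measurable_EFinP; exact: measurable_int i1.
have md2 : measurable_fun setT d2 by apply/measurable_EFinP; exact: measurable_int i2.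
apply: ge0_ae_eq_integral_nonmeas => //.
- apply: measurable_funTS; apply/measurable_EFinP; apply: measurable_funD.
    by apply: measurable_funM => //; exact: measurable_funX.
  by apply: measurable_funM => //; exact: measurable_funX.
- by move=> s _; rewrite lee_fin addr_ge0// mulr_ge0 ?sqr_ge0// ltW.
- by move=> s _; rewrite lee_fin addr_ge0// mulr_ge0 ?sqr_ge0// ltW.
- apply: filterS D12; first exact: (ae_filter_ringOfSetsType mu).
  by move=> s h sT; have [-> ->] := h sT.
Qed.

Lemma quadratic_integrable (d1 d2 : R -> R) :
  mu.-integrable setT (EFin \o d1) -> mu.-integrable setT (EFin \o d2) ->
  (\int[mu]_(s in `[0%R, T]) (c1 * d1 s ^+ 2 + c2 * d2 s ^+ 2)%:E < +oo)%E ->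
  mu.-integrable `[0, T] (EFin \o (fun s => c1 * d1 s ^+ 2 + c2 * d2 s ^+ 2)).
Proof.
move=> i1 i2 fin.
have md1 : measurable_fun setT d1 by apply/measurable_EFinP; exact: measurable_int i1.
have md2 : measurable_fun setT d2 by apply/measurable_EFinP; exact: measurable_int i2.
apply/integrableP; split.
  apply: measurable_funTS; apply/measurable_EFinP; apply: measurable_funD.
    by apply: measurable_funM => //; exact: measurable_funX.
  by apply: measurable_funM => //; exact: measurable_funX.
under eq_integral.
  move=> s _; rewrite gee0_abs; last first.
    by rewrite lee_fin addr_ge0// mulr_ge0 ?sqr_ge0// ltW.
  over.
exact: fin.
Qed.

(** [energy_young] is integrated over [s, t]; the term q y (t - s) is the contribution of the drift
    of the free path. *)
Lemma energy_increment (x y : R) : cpath psi.1 -> cpath psi.2 ->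
  (energy c1 c2 T psi < +oo)%E ->
  exists E : R -> R, [/\ E 0 = 0, energy c1 c2 T psi = (E T)%:E &
    forall q s t, 0 <= s -> s <= t -> t <= T ->
      q * (free_path x y psi t - free_path x y psi s) <=
      E t - E s + (q ^+ 2 / (4 * c) + q * y) * (t - s)].
Proof.
move=> [_ p10] [_ p20] Eoo.
have [ac1 ac2] : abs_continuous_on 0 T psi.1 /\ abs_continuous_on 0 T psi.2.
  by move: Eoo; rewrite /energy; case: asboolP => // _; rewrite ltxx.
have [d1 [d2 [i1 i2 dE _ eE]]] := energy_density ac1 ac2.
pose e s := c1 * d1 s ^+ 2 + c2 * d2 s ^+ 2.
have ie : mu.-integrable `[0, T] (EFin \o e).
  by apply: quadratic_integrable => //; rewrite -eE.
pose E t := \int[mu]_(s in `[0, t]) e s.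
exists E; split.
- by rewrite /E set_itv1 Rintegral_set1.
- rewrite eE /E /Rintegral fineK//; exact: integrable_fin_num.
move=> q s t s0 st tT.
pose f u := e u - q * (d1 u - d2 u).
have i12 : mu.-integrable `[0, T] (EFin \o (fun u => d1 u - d2 u)).
  rewrite [X in mu.-integrable _ X](_ : _ = (EFin \o d1) \- (EFin \o d2))%E.
    by apply: integrableB => //; [exact: integrableS i1|exact: integrableS i2].
  by apply/funext => u /=; rewrite EFinB.
have iq : mu.-integrable `[0, T] (EFin \o (fun u => q * (d1 u - d2 u))).
  rewrite [X in mu.-integrable _ X](_ : _ =
    (fun u => q%:E * (EFin \o (fun u => (d1 u - d2 u)%R)) u))%E.
    exact: integrableZl.
  by apply/funext => u /=; rewrite EFinM.
have if' : mu.-integrable `[0, T] (EFin \o f).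
  rewrite [X in mu.-integrable _ X](_ : _ =
    (EFin \o e) \- (EFin \o (fun u => (q * (d1 u - d2 u))%R)))%E.
    exact: integrableB.
  by apply/funext => u /=; rewrite EFinB.
have fE u : 0 <= u -> u <= T ->
    \int[mu]_(s in `[0, u]) f s = E u - q * (psi.1 u - psi.2 u).
  move=> u0 uT; have sub : `[0, u] `<=` `[0, T].
    by apply: subset_itvl; rewrite bnd_simp.
  have uT' : u \in `[0, T] by rewrite in_itv/= u0.
  rewrite RintegralB//; [|exact: integrableS ie|exact: integrableS iq].
  rewrite RintegralZl//; last exact: integrableS i12.
  rewrite RintegralB//; [|exact: integrableS i1|exact: integrableS i2].
  have [<- <-] := dE u uT'.
  by rewrite p10 p20 !subr0.
have := @Rintegral_itv_ge _ f 0 T (- (q ^+ 2 / (4 * c))) s t if' s0 st tT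
  (fun u _ _ => energy_young _ _ _).
have t0 := le_trans s0 st; have sT := le_trans st tT.
rewrite !fE// /free_path; lra.
Qed.

End energies.

(** * Upper bound for a positive barrier *)

Section upper_bound.
Context (R : realType).
Notation mu := (@lebesgue_measure R).
Variables (c1 c2 r y b x : R) (h : R -> R).
Hypotheses (c10 : 0 < c1) (c20 : 0 < c2) (r0 : 0 < r) (b0 : 0 < b) (x0 : 0 <= x).
Notation c := (cpar c1 c2).
Hypotheses (ry : r / (4 * c) <= - y) (ch : {within `[0, b], continuous h}).
Hypotheses (h_ge0 : forall z, 0 <= z -> z <= b -> 0 <= h z) (h0 : h 0 = 0).
Hypothesis hr : forall z, 0 <= z -> z <= b -> r ^+ 2 / (4 * c) + r * y + h z <= 0.

Lemma within_continuous_comp (A B : set R) (f g : R -> R) :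
  (forall t, A t -> B (f t)) -> {within A, continuous f} ->
  {within B, continuous g} -> {within A, continuous (g \o f)}.
Proof.
move=> AB cf cg; apply/within_continuousP => t e At e0.
have [d d0 Hd] := (within_continuousP _ _).1 cg _ e (AB _ At) e0.
have [d' d'0 Hd'] := (within_continuousP _ _).1 cf _ d At d0.
by exists d' => // u Au ut; apply: Hd; [exact: AB|exact: Hd'].
Qed.

Lemma free_path_continuous (psi : (R -> R) * (R -> R)) : cpath psi.1 ->
  cpath psi.2 -> {within `[0, +oo[, continuous (free_path x y psi)}.
Proof.
move=> [cp1 _] [cp2 _] t; apply: cvgB; last exact: cp2.
apply: cvgD; last exact: cp1.
apply: cvgD; first exact: cvg_cst.
apply: cvgM; first exact: cvg_cst.
by move: t; apply: continuous_subspaceT => t; exact: cvg_id.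
Qed.

Variables (T : R) (psi ctl : (R -> R) * (R -> R)) (phi : R -> R).
Hypotheses (T0 : 0 <= T) (cp1 : cpath psi.1) (cp2 : cpath psi.2).
Hypothesis sk : skorohod 0 b (free_path x y psi) phi ctl.1 ctl.2.

Let phi_cont : {within `[0, +oo[, continuous phi}.
Proof. exact: (skorohod_continuous b0 (free_path_continuous cp1 cp2) sk). Qed.

Let phib t : 0 <= t -> 0 <= phi t <= b.
Proof. by have [_ H _ _ _] := sk => /H; rewrite in_itv. Qed.

Lemma skorohod_running_cost :
  {within `[0, T], continuous (h \o phi)} /\
  (\int[mu]_(t in `[0%R, T]) (h (dynamics x y psi ctl t))%:E)%E =
  (\int[mu]_(t in `[0, T]) h (phi t))%:E.
Proof.
have chp : {within `[0, T], continuous (h \o phi)}.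
  apply: (within_continuous_comp (B := `[0, b])) => //.
    by move=> t; rewrite /= in_itv/= => /andP[/phib + _]; rewrite in_itv.
  apply: continuous_subspaceW phi_cont.
  by apply: subset_itvl; rewrite bnd_simp.
split => //; rewrite /Rintegral fineK.
  apply: eq_integral => t; rewrite inE/= in_itv/= => /andP[t0 _].
  by have [H _ _ _ _] := sk; rewrite (H _ t0).
by apply: integrable_fin_num => //; exact: continuous_itv_integrable.
Qed.

Lemma skorohod_start : x <= b -> ctl.2 0 = 0 /\ phi 0 = x.
Proof.
have [phiE _ [[_ _ z0] [_ _ p0]] nz np] := sk.
have w0 : free_path x y psi 0 = x.
  by rewrite /free_path (proj2 cp1) (proj2 cp2) mulr0; ring.
have := phiE 0 (lexx _); rewrite w0 => phi0.
have /andP[ph0 phb] := phib (lexx 0).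
have p_start : phi 0 < b -> ctl.2 0 = 0.
  move=> pb; apply: (stieltjes_null_start np) => //=; first exact: p0.
  by rewrite in_itv/= ph0.
have z_start : 0 < phi 0 -> ctl.1 0 = 0.
  move=> pb; apply: (stieltjes_null_start nz) => //=; first exact: z0.
  by rewrite in_itv/= pb.
have := z0 0 (lexx _); have := p0 0 (lexx _) => pge zge xb.
have [pb|pb] := ltP (phi 0) b.
  have pz := p_start pb; split => //.
  have [pp|pp] := ltP 0 (phi 0); first by rewrite phi0 z_start// pz; ring.
  by move: phi0; rewrite pz => phi0; apply/eqP; rewrite eq_le (le_trans pp x0)/=; lra.
by move: phi0; rewrite (z_start (lt_le_trans b0 pb)); split; lra.
Qed.

(** Neither control can act away from its barrier at time 0, so the only jump is down to [b]. Its
    cost r (x - b) is the affine part of g. *)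
Lemma skorohod_start_gt : b < x -> ctl.2 0 = x - b /\ phi 0 = b.
Proof.
have [phiE _ [[_ _ z0] [_ _ p0]] nz np] := sk.
have w0 : free_path x y psi 0 = x.
  by rewrite /free_path (proj2 cp1) (proj2 cp2) mulr0; ring.
have := phiE 0 (lexx _); rewrite w0 => phi0 bx.
have /andP[ph0 phb] := phib (lexx 0).
have zge := z0 0 (lexx _).
have [pb|pb] := ltP (phi 0) b.
  have pz : ctl.2 0 = 0.
    apply: (stieltjes_null_start np) => //=; first exact: p0.
    by rewrite in_itv/= ph0.
  by move: phi0; rewrite pz; lra.
have zz : ctl.1 0 = 0.
  apply: (stieltjes_null_start nz) => //=.
  by rewrite in_itv/= phb andbT (lt_le_trans b0).
by move: phi0; rewrite zz; split; lra.
Qed.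

Lemma barrier_cost_le :
  (cost c1 c2 r y h x T psi ctl <=
   (if x <= b then gint c y h x else gint c y h b + r * (x - b))%:E)%E.
Proof.
have [chp runE] := skorohod_running_cost.
rewrite /cost runE.
have [Eoo|] := ltP (energy c1 c2 T psi) +oo%E; last first.
  by rewrite leye_eq => /eqP ->; rewrite addeNy leNye.
have [E [E0 -> Einc]] := energy_increment c10 c20 T0 x y cp1 cp2 Eoo.
rewrite -!EFinD lee_fin.
have c0 := cpar_gt0 c10 c20.
have y0 : y <= 0.
  by rewrite -oppr_ge0 (le_trans _ ry)// divr_ge0 ?mulr_ge0// ltW.
pose k z := hroot c y (h z).
have ck : {within `[0, b], continuous k} by exact: hroot_continuous.
pose G := gint c y h.
have ik := continuous_itv_integrable ck.
have ihp := continuous_itv_integrable chp.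
have [phiE _ [[_ ndz z0] [_ ndp p0]] nz np] := sk.
pose Q t := \int[mu]_(s in `[0, t]) h (phi s).
have rayT (u : R) : 0 <= u -> [set` `[0, +oo[] u by move=> u0; rewrite /= in_itv/= u0.
have k0 : k 0 = 0 by rewrite /k h0 hroot0.
have kr z : 0 <= z -> z <= b -> 0 <= k z <= r.
  move=> z0' zb; rewrite /k; apply/andP; split.
    by apply: (hroot_ge0 (r := r)) => //; exact: h_ge0.
  by apply: hroot_le => //; exact: hr.
have := @verification R T b c r y (free_path x y psi) phi ctl.1 ctl.2 E Q h k G
  T0 b0 c0 r0.
move=> /(_ (fun t t0 _ => phiE t t0) (fun t t0 _ => phib t0)) H.
(* The initial value of the monotone quantity, initial jump included, is exactly g(x); at time [T]
   the nonnegative term G(phi(T)) is dropped. *)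
apply: le_trans (_ : Q 0 + r * ctl.2 0 - E 0 + G (phi 0) <= _); last first.
  rewrite /Q set_itv1 Rintegral_set1 E0 subr0 add0r.
  case: ifPn => [xb|]; last rewrite -ltNge => bx.
    by have [-> ->] := skorohod_start xb; rewrite mulr0 add0r.
  by have [-> ->] := skorohod_start_gt bx; rewrite addrC.
apply: le_trans (H _ _ _ _ _ _ _ _ _ k0 kr _ _).
- rewrite lerDl /G /gint Rintegral_ge0// => u; rewrite /= in_itv/= => /andP[u0 ub].
  have /andP[_ pb] := phib T0.
  by have /andP[+ _] := kr u u0 (le_trans ub pb).
- move=> t t0 tT e e0.
  have [d d0 Hd] := (within_continuousP _ _).1 phi_cont t e (rayT _ t0) e0.
  by exists d => // u u0 uT; apply: Hd; exact: rayT.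
- move=> s t s0 st tT pos; apply: (stieltjes_null_cst nz) => // u su ut /=.
  by rewrite in_itv/= pos//; have /andP[] := phib (le_trans s0 (ltW su)).
- move=> s t s0 st tT pos; apply: (stieltjes_null_cst np) => // u su ut /=.
  by rewrite in_itv/= pos// andbT; have /andP[] := phib (le_trans s0 (ltW su)).
- move=> t e t0 tT e0.
  have [s [s0 st Hs]] := skorohod_left b0 (free_path_continuous cp1 cp2) sk t0 e0.
  by exists s; split => // u su ut; have [] := Hs u su ut.
- exact: Einc.
- move=> M s t s0 st tT HM.
  exact: (@Rintegral_itv_le _ (h \o phi) 0 T).
- move=> M u v u0 uv vb HM; exact: (@Rintegral_itv_le _ k 0 b).
- move=> M u v u0 uv vb HM; exact: (@Rintegral_itv_ge _ k 0 b).
- move=> z z0' zb e e0.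
  have zI : [set` `[0, b]] z by rewrite /= in_itv/= z0'.
  have [d d0 Hd] := (within_continuousP _ _).1 ck z e zI e0.
  have [d' d'0 Hd'] := (within_continuousP _ _).1 ch z e zI e0.
  exists (Num.min d d'); first by rewrite lt_min d0.
  move=> u u0 ub; rewrite lt_min => /andP[ud ud'].
  have uI : [set` `[0, b]] u by rewrite /= in_itv/= u0.
  by split; [exact: Hd|exact: Hd'].
- move=> z z0' zb; by rewrite /k (hroot_hjb c0 (hr z0' zb)).
- by rewrite [y * r]mulrC; apply: hr; [exact: ltW|exact: lexx].
Qed.

End upper_bound.

(** * Upper bound for the barrier at zero *)

Section zero_barrier.
Context (R : realType).
Notation mu := (@lebesgue_measure R).
Variables (c1 c2 r y x : R) (h : R -> R).
Hypotheses (c10 : 0 < c1) (c20 : 0 < c2) (r0 : 0 < r).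
Notation c := (cpar c1 c2).
Hypotheses (ry : r ^+ 2 / (4 * c) + r * y <= 0) (h0 : h 0 = 0).
Variables (T : R) (psi ctl : (R -> R) * (R -> R)).
Hypotheses (T0 : 0 <= T) (cp1 : cpath psi.1) (cp2 : cpath psi.2).
Hypothesis ctlE : abs_continuous_on 0 T psi.1 -> abs_continuous_on 0 T psi.2 ->
  forall t, t \in `[0, T] ->
    ctl.1 t = \int[mu]_(s in `[0, t]) Num.max (- drift y psi s) 0 /\
    ctl.2 t = x + \int[mu]_(s in `[0, t]) Num.max (drift y psi s) 0.

(** The controls cancel the drift, so the path stays at 0 and the running cost vanishes. By Young's
    inequality with slope [r] and r^2/(4c) + r y <= 0, r times the positive part of the drift is at
    most the energy density, leaving only the initial push r x. *)
Lemma zero_barrier_cost_le : (cost c1 c2 r y h x T psi ctl <= (r * x)%:E)%E.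
Proof.
rewrite /cost.
have [Eoo|] := ltP (energy c1 c2 T psi) +oo%E; last first.
  by rewrite leye_eq => /eqP ->; rewrite addeNy leNye.
have [ac1 ac2] : abs_continuous_on 0 T psi.1 /\ abs_continuous_on 0 T psi.2.
  by move: Eoo; rewrite /energy; case: asboolP => // _; rewrite ltxx.
have [d1 [d2 [i1 i2 dE daE eE]]] := energy_density c10 c20 T0 ac1 ac2.
have md1 : measurable_fun setT d1 by apply/measurable_EFinP; exact: measurable_int i1.
have md2 : measurable_fun setT d2 by apply/measurable_EFinP; exact: measurable_int i2.
pose dd s := d1 s - d2 s + y.
have i12 : mu.-integrable setT (EFin \o (fun u => d1 u - d2 u)).
  rewrite [X in mu.-integrable _ X](_ : _ = (EFin \o d1) \- (EFin \o d2))%E.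
    exact: integrableB.
  by apply/funext => u /=; rewrite EFinB.
have icst t : mu.-integrable `[0, t] (EFin \o (fun=> y)).
  by apply: continuous_itv_integrable => ?; exact: cvg_cst.
have idd t : mu.-integrable `[0, t] (EFin \o dd).
  rewrite [X in mu.-integrable _ X](_ : _ =
    (EFin \o (fun u => (d1 u - d2 u)%R)) \+ (EFin \o (fun=> y)))%E.
    by apply: integrableD => //; exact: integrableS i12.
  by apply/funext => u /=; rewrite EFinD.
have ipos t : mu.-integrable `[0, t] (EFin \o dd^\+) by exact: integrable_funrpos.
have ineg t : mu.-integrable `[0, t] (EFin \o dd^\-) by exact: integrable_funrneg.
(* The strategy integrates pointwise derivatives; for nonnegative integrands these may be exchanged
   for the measurable densities. *)
have ae_int (f : R -> R) t : t <= T -> (measurable_fun setT f) -> (forall s, 0 <= f s) ->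
    \int[mu]_(s in `[0, t]) f (drift y psi s) = \int[mu]_(s in `[0, t]) f (dd s).
  move=> tT mf f0; rewrite /Rintegral; congr fine.
  apply: ge0_ae_eq_integral_nonmeas => //.
  - apply: measurable_funTS; apply/measurable_EFinP.
    apply: measurableT_comp => //; apply: measurable_funD => //.
    exact: measurable_funB.
  - by move=> s _; rewrite lee_fin.
  - by move=> s _; rewrite lee_fin.
  - apply: filterS daE; first exact: (ae_filter_ringOfSetsType mu).
    move=> s hs; rewrite /= in_itv/= => /andP[s0 st].
    have [|e1 e2] := hs; first by rewrite in_itv/= s0 (le_trans st).
    by rewrite /drift e1 e2.
pose P t := \int[mu]_(s in `[0, t]) dd^\+ s.
have ctl1 t : 0 <= t -> t <= T -> ctl.1 t = \int[mu]_(s in `[0, t]) dd^\- s.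
  move=> t0 tT; have tI : t \in `[0, T] by rewrite in_itv/= t0.
  rewrite (ctlE ac1 ac2 tI).1.
  apply: (ae_int (fun z => Num.max (- z) 0)) => //.
    by apply: measurable_maxr => //; exact: oppr_measurable.
  by move=> s; rewrite le_max lexx orbT.
have ctl2 t : 0 <= t -> t <= T -> ctl.2 t = x + P t.
  move=> t0 tT; have tI : t \in `[0, T] by rewrite in_itv/= t0.
  rewrite (ctlE ac1 ac2 tI).2; congr (_ + _).
  apply: (ae_int (fun z => Num.max z 0)) => //.
    exact: measurable_maxr.
  by move=> s; rewrite le_max lexx orbT.
have dyn0 t : 0 <= t -> t <= T -> dynamics x y psi ctl t = 0.
  move=> t0 tT; rewrite /dynamics (ctl1 t t0 tT) (ctl2 t t0 tT).
  have tI : t \in `[0, T] by rewrite in_itv/= t0.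
  have [p1 p2] := dE t tI.
  rewrite (proj2 cp1) subr0 in p1; rewrite (proj2 cp2) subr0 in p2.
  have : P t - \int[mu]_(s in `[0, t]) dd^\- s = \int[mu]_(s in `[0, t]) dd s.
    rewrite /P -RintegralB//; apply: eq_Rintegral => s _.
    by rewrite -[in RHS](funrposBneg dd).
  rewrite RintegralD//; last exact: integrableS i12.
  rewrite RintegralB//; [|exact: integrableS i1|exact: integrableS i2].
  rewrite -p1 -p2 Rintegral_cst//= lebesgue_measure_itv/= lte_fin.
  have -> : fine (if 0 < t then (t%:E - 0%:E)%E else 0%E) = t.
    by case: ltP => [_/=|t0']; [rewrite subr0|apply/eqP; rewrite eq_le t0].
  lra.
rewrite (_ : integral _ _ _ = 0%E) ?add0e; last first.
  apply: integral0_eq => t; rewrite /= in_itv/= => /andP[t0 tT].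
  by rewrite dyn0// h0.
have ie : mu.-integrable `[0, T] (EFin \o (fun s => c1 * d1 s ^+ 2 + c2 * d2 s ^+ 2)).
  by apply: quadratic_integrable => //; rewrite -eE.
rewrite eE -[X in (_ - X)%E]fineK; last exact: integrable_fin_num.
rewrite -EFinB lee_fin ctl2// mulrDr -addrA gerDl subr_le0 /P.
rewrite -RintegralZl//; apply: le_Rintegral => //.
  rewrite [X in mu.-integrable _ X](_ : _ = (fun s => r%:E * (EFin \o (dd^\+)%R) s))%E.
    exact: integrableZl.
  by apply/funext => s /=; rewrite EFinM.
move=> s _; have := energy_young c10 c20 r (d1 s) (d2 s).
rewrite /funrpos /dd; case: (leP (d1 s - d2 s + y) 0) => hd; last by have := ry; lra.
by rewrite mulr0 addr_ge0// mulr_ge0 ?sqr_ge0// ltW.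
Qed.

End zero_barrier.

(** * Lower bound *)

Section flow.
Context (R : realType).
Notation mu := (@lebesgue_measure R).

Lemma is_derive_continuous (f : R -> R) (x l : R) :
  is_derive x 1 f l -> {for x, continuous f}.
Proof.
by move=> H; apply/differentiable_continuous/derivable1_diffP; exact: ex_derive.
Qed.

Lemma continuous_integrable (f : R -> R) (a b : R) : continuous f ->
  mu.-integrable `[a, b] (EFin \o f).
Proof. by move=> cf; apply: continuous_itv_integrable; exact: continuous_subspaceT. Qed.

Lemma is_derive_primitive (f : R -> R) (a x : R) : continuous f -> a < x ->
  is_derive x 1 (fun z => \int[mu]_(s in `[a, z]) f s) (f x).
Proof.
move=> cf ax; have xx : x < x + 1 by rewrite ltrDl.
have [dF F'] := continuous_FTC1_closed xx (continuous_integrable _ _ cf) ax (cf x).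
exact: (DeriveDef dF (etrans (esym (derive1E _ _)) F')).
Qed.

Lemma derive_itv_FTC (f F : R -> R) (T : R) : 0 < T ->
  {within `[0, T], continuous f} ->
  (forall t, 0 <= t -> t <= T -> is_derive t 1 F (f t)) ->
  \int[mu]_(s in `[0, T]) f s = F T - F 0.
Proof.
move=> T0 cf dF; rewrite /Rintegral (@continuous_FTC2 _ _ F)//.
- split.
  + move=> t; rewrite in_itv/= => /andP[/ltW t0 /ltW tT]; exact: (@ex_derive _ _ _ _ _ _ _) (dF t t0 tT).
  + apply: cvg_at_right_filter; exact: is_derive_continuous (dF 0 (lexx _) (ltW T0)).
  + apply: cvg_at_left_filter; exact: is_derive_continuous (dF T (ltW T0) (lexx _)).
- move=> t; rewrite in_itv/= => /andP[/ltW t0 /ltW tT].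
  by rewrite derive1E; exact: (@derive_val _ _ _ _ _ _ _) (dF t t0 tT).
Qed.

(* The flow is the inverse of the time [A z] needed to travel at speed [v]. *)
Lemma decreasing_flow (v : R -> R) (m M x0 : R) : continuous v -> 0 < m ->
  (forall z, m <= v z <= M) -> 0 < x0 ->
  exists (X : R -> R) (T : R), [/\ 0 < T, X 0 = x0, X T = 0 &
    forall t, 0 <= t -> t <= T ->
      0 <= X t <= x0 /\ is_derive t 1 X (- v (X t))].
Proof.
move=> cv m0 vmM x00.
have v0 z : 0 < v z by apply: lt_le_trans m0 _; have /andP[] := vmM z.
have M0 : 0 < M by rewrite (lt_le_trans m0)//; have /andP[/le_trans] := vmM 0; apply.
pose q (z : R) := (v z)^-1.
have cq : continuous q.
  by move=> z; apply: cvgV; [rewrite gt_eqF|exact: cv].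
(* Starting the integral at -1 makes [A] differentiable on both sides of 0, the end point of the
   motion; [D] below likewise contains a neighbourhood of [0, x0], for the derivative of the
   inverse. *)
pose A (z : R) := \int[mu]_(s in `[-1, z]) q s.
have dA (z : R) : -1 < z -> is_derive z 1 A (q z) by move=> z1; exact: is_derive_primitive.
have Alt (u w : R) : -1 <= u -> u < w -> A u < A w.
  move=> u1 uw; rewrite -subr_gt0.
  apply: lt_le_trans (_ : M^-1 * (w - u) <= _).
    by rewrite mulr_gt0 ?invr_gt0// subr_gt0.
  apply: (@Rintegral_itv_ge _ q (-1) w) => //; [exact: continuous_integrable|exact: ltW|].
  move=> z _ _; rewrite /q lef_pV2 ?posrE//.
  by have /andP[] := vmM z.
pose D := [set` `[- 2^-1, x0 + 1]].
have h2 : -1 <= - 2^-1 :> R by rewrite lerN2 invf_le1// ler1n.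
have Ainj : {in D &, injective A}.
  move=> u w; rewrite !inE /D /= !in_itv/= => /andP[u1 _] /andP[w1 _] AA.
  have u1' := le_trans h2 u1; have w1' := le_trans h2 w1.
  by case: (ltgtP u w) => // uw; [have := Alt u w u1' uw|have := Alt w u w1' uw];
    rewrite AA ltxx.
pose gi := 'pinv_(fun=> 0) D A.
have giK (z : R) : - 2^-1 <= z -> z <= x0 + 1 -> gi (A z) = z.
  by move=> z1 z2; apply: pinvKV => //; rewrite inE /D /= in_itv/= z1.
have hN : - 2^-1 < 0 :> R by rewrite oppr_lt0 invr_gt0.
have h1 : -1 < 0 :> R by rewrite oppr_lt0.
have dgi (z : R) : 0 <= z -> z <= x0 -> is_derive (A z) 1 gi (v z).
  move=> z0 zx; rewrite -[v z]invrK; apply: is_derive_inverse.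
  - near=> u; apply: giK; apply: ltW; near: u.
      by apply: lt_nbhsr; exact: lt_le_trans z0.
    by apply: lt_nbhsl; rewrite (le_lt_trans zx)// ltrDl.
  - near=> u; apply: is_derive_continuous (dA u _); near: u.
    by apply: lt_nbhsr; exact: lt_le_trans z0.
  - by apply: dA; exact: lt_le_trans z0.
  - by rewrite invr_eq0 gt_eqF.
pose T := A x0 - A 0.
exists (fun t => gi (A x0 - t)), T; split.
- by rewrite subr_gt0 Alt// ltW.
- by rewrite subr0; apply: giK; [exact: le_trans (ltW hN) (ltW x00)|rewrite lerDl].
- by rewrite /T opprB addrC subrK; apply: giK; [exact: ltW|rewrite addr_ge0// ltW].
move=> t t0 tT.
have cA : {within `[0, x0], continuous A}.
  apply: derivable_within_continuous => z; rewrite in_itv/= => /andP[z0 _].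
  exact: (@ex_derive _ _ _ _ _ _ _) (dA z (lt_le_trans h1 z0)).
have [|z zI Az] := @IVT _ A 0 x0 (A x0 - t) (ltW x00) cA.
  have A0 : A 0 <= A x0 by rewrite ltW// Alt// ltW.
  rewrite (min_l A0) (max_r A0).
  by move: tT; rewrite /T => tT; apply/andP; split; lra.
move: zI; rewrite in_itv/= => /andP[z0 zx].
have Xt : gi (A x0 - t) = z.
  rewrite -Az; apply: giK; first exact: le_trans (ltW hN) z0.
  by rewrite (le_trans zx)// lerDl.
rewrite Xt z0 zx; split => //.
have -> : - v z = v z * -1 by rewrite mulrN1.
apply: (@is_derive1_comp _ gi (fun t => A x0 - t)).
  by rewrite -Az; exact: dgi.
rewrite -[X in is_derive _ _ _ X]sub0r; apply: is_deriveB.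
Unshelve. all: by end_near. Qed.

End flow.

(** * Comparison of the controlled path with a prescribed one *)

Section comparison.
Context (R : realType).
Variables (b x y T : R) (psi ctl : (R -> R) * (R -> R)) (phi X : R -> R).
Hypotheses (b0 : 0 < b) (x0 : 0 <= x) (T0 : 0 <= T).
Hypotheses (cp1 : cpath psi.1) (cp2 : cpath psi.2).
Hypothesis sk : skorohod 0 b (free_path x y psi) phi ctl.1 ctl.2.
Hypotheses (cX : {within `[0, T], continuous X}) (X0 : X 0 = Num.min x b).
Hypothesis Xb : forall t, 0 <= t -> t <= T -> X t <= b.
Hypothesis freeE : forall t, 0 <= t -> t <= T ->
  free_path x y psi t = x - Num.min x b + X t.

Lemma skorohod_pushed : x - Num.min x b <= ctl.2 T.
Proof.
have [_ _ [_ [_ ndp p0]] _ _] := sk.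
have [xb|bx] := leP x b; first by rewrite subrr p0.
have [<- _] := skorohod_start_gt b0 cp1 cp2 sk bx.
by apply: ndp => //; rewrite in_itv/= ?lexx ?T0.
Qed.

(** After the last time with phi >= X the path is below X <= b, so the downward control rests, while
    the upward one can only raise phi - X: the difference cannot become negative. *)
Lemma skorohod_ge t : 0 <= t -> t <= T -> X t <= phi t.
Proof.
move=> t0 tT; rewrite leNgt; apply/negP => Xphi.
have [phiE phib [[_ ndz z0] [_ ndp p0]] nz np] := sk.
have cphi := skorohod_continuous b0 (free_path_continuous cp1 cp2) sk.
have cd : {within `[0, T], continuous (fun t => phi t - X t)}.
  move=> u; apply: cvgB; last exact: cX.
  move: u; apply: continuous_subspaceW cphi.
  by apply: subset_itvl; rewrite bnd_simp.
have [||a [a0 a_t da ad]] := @last_nonneg _ (fun t => phi t - X t) 0 t t0.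
- move=> u u0 ut e e0.
  have uI : [set` `[0, T]] u by rewrite /= in_itv/= u0 (le_trans ut).
  have [d d0 Hd] := (within_continuousP _ _).1 cd u e uI e0.
  exists d => // w w0 wt; apply: Hd.
  by rewrite /= in_itv/= w0 (le_trans wt).
- have [xb|bx] := leP x b.
    by have [_ ->] := skorohod_start b0 x0 cp1 cp2 sk xb; rewrite X0 min_l// subrr.
  by have [_ ->] := skorohod_start_gt b0 cp1 cp2 sk bx; rewrite X0 (min_r (ltW bx)) subrr.
have aT := le_trans a_t tT.
have pta : ctl.2 t = ctl.2 a.
  apply: (stieltjes_null_cst np) => // u au ut /=.
  have u0 : 0 <= u := le_trans a0 (ltW au).
  have := phib u u0; rewrite !in_itv/= => /andP[-> _] /=.
  have := ad u au ut; rewrite subr_lt0 => /lt_le_trans; apply.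
  by apply: Xb => //; exact: le_trans ut tT.
have zta : ctl.1 a <= ctl.1 t by apply: ndz => //; rewrite in_itv/= ?a0 ?t0.
move: da Xphi; rewrite (phiE a a0) (phiE t t0) !freeE// pta; lra.
Qed.

End comparison.

Section lower_bound.
Context (R : realType).
Notation mu := (@lebesgue_measure R).

Lemma lipschitz_abs_continuous (a b L : R) (f : R -> R) : 0 < L ->
  (forall u v, a <= u -> u <= v -> v <= b -> `|f v - f u| <= L * (v - u)) ->
  abs_continuous_on a b f.
Proof.
move=> L0 H e e0; exists (e / L); first by rewrite divr_gt0.
move=> n u v uv _; rewrite ltr_pdivlMr// mulr_suml => /(le_lt_trans _); apply.
apply: ler_sum => i _; have [au [uvi vb]] := uv i.
by rewrite mulrC H.
Qed.

Lemma derive_lipschitz (T L : R) (f df : R -> R) :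
  (forall t, 0 <= t -> t <= T -> is_derive t 1 f (df t)) ->
  (forall t, 0 <= t -> t <= T -> `|df t| <= L) ->
  forall u v, 0 <= u -> u <= v -> v <= T -> `|f v - f u| <= L * (v - u).
Proof.
move=> dfE dfL u v u0; rewrite le_eqVlt => /predU1P[->|uv] vT.
  by rewrite !subrr normr0 mulr0.
have cf : {within `[u, v], continuous f}.
  apply: derivable_within_continuous => s; rewrite in_itv/= => /andP[us sv].
  apply: (@ex_derive _ _ _ _ _ _ _) (dfE s _ _); first exact: le_trans u0 us.
  exact: le_trans sv vT.
have dfuv s : s \in `]u, v[ -> is_derive s 1 f (df s).
  rewrite in_itv/= => /andP[us sv].
  by apply: dfE; [exact: le_trans u0 (ltW us)|exact: le_trans (ltW sv) vT].
have [s + ->] := MVT uv dfuv cf.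
rewrite in_itv/= => /andP[us sv].
rewrite normrM [`|v - u|]ger0_norm ?subr_ge0 ?(ltW uv)//.
rewrite ler_pM2r ?subr_gt0//; apply: dfL; first exact: le_trans u0 (ltW us).
exact: le_trans (ltW sv) vT.
Qed.

(* Splitting the velocity u between the two paths in the ratio c2 : c1 makes
   the energy equal to c u^2, its minimum for a given difference. *)
Lemma path_split (c1 c2 T L : R) (Y dY : R -> R) : 0 < c1 -> 0 < c2 -> 0 < T ->
  0 < L -> Y 0 = 0 ->
  (forall t, 0 <= t -> t <= T -> is_derive t 1 Y (dY t)) ->
  (forall t, 0 <= t -> t <= T -> `|dY t| <= L) ->
  {within `[0, T], continuous dY} ->
  exists psi : (R -> R) * (R -> R), [/\ cpath psi.1, cpath psi.2,
    forall t, 0 <= t -> t <= T -> psi.1 t - psi.2 t = Y t &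
    energy c1 c2 T psi = (\int[mu]_(t in `[0, T]) (cpar c1 c2 * dY t ^+ 2))%:E].
Proof.
move=> c10 c20 T0 L0 Y0 HY HdY cdY.
set c := cpar c1 c2.
have cY : {within `[0, T], continuous Y}.
  apply: derivable_within_continuous => t; rewrite in_itv/= => /andP[t0 tT].
  exact: (@ex_derive _ _ _ _ _ _ _) (HY t t0 tT).
(* Nothing is assumed about [Y] after [T], whereas a path must be continuous on the whole
   half-line. *)
pose Z t := Y (Num.min t T).
have cZ : {within `[0, +oo[, continuous Z}.
  apply: (within_continuous_comp (B := `[0, T])) => //.
    by move=> t; rewrite /= !in_itv/= andbT le_min ge_min lexx (ltW T0) orbT !andbT.
  apply: continuous_subspaceT => t; apply: continuous_min; first exact: cvg_id.
  exact: cvg_cst.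
have ZE t : t <= T -> Z t = Y t by move=> tT; rewrite /Z min_l.
have cpZ k : cpath (fun t => k * Z t).
  split; last by rewrite ZE ?ltW// Y0 mulr0.
  by move=> t; apply: cvgM; [exact: cvg_cst|exact: cZ].
have acZ k : abs_continuous_on 0 T (fun t => k * Z t).
  apply: (@lipschitz_abs_continuous _ _ (`|k| * L + 1)).
    by rewrite ltr_wpDl// mulr_ge0// ltW.
  move=> u v u0 uv vT; rewrite !ZE// ?(le_trans uv)// -mulrBr normrM.
  rewrite mulrDl mul1r ler_wpDr ?subr_ge0// -mulrA ler_wpM2l//.
  exact: (derive_lipschitz HY HdY).
exists ((fun t => c / c1 * Z t), (fun t => - (c / c2) * Z t)); split.
- exact: cpZ.
- exact: cpZ.
- move=> t t0 tT; rewrite /= -mulrBl ZE// opprK.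
  have -> : c / c1 + c / c2 = 1.
    by rewrite -mulrDr /c /cpar mulVf// gt_eqF// addr_gt0// invr_gt0.
  by rewrite mul1r.
rewrite /energy asboolT//=.
have ci : mu.-integrable `[0, T] (EFin \o (fun t => c * dY t ^+ 2)).
  apply: continuous_itv_integrable => t; apply: cvgM; first exact: cvg_cst.
  by rewrite expr2; apply: cvgM; exact: cdY.
have c0 : 0 < c by exact: cpar_gt0.
have -> : (\int[mu]_(t in `[0, T]) (c * dY t ^+ 2))%:E =
    (\int[mu]_(t in `[0%R, T]) (c * dY t ^+ 2)%:E)%E.
  by rewrite /Rintegral fineK//; exact: integrable_fin_num.
have dZ k t : 0 < t -> t < T -> (fun t => k * Z t)^`()%classic t = k * dY t.
  move=> t0 tT; rewrite derive1E.
  have dk : is_derive t 1 (fun t => k * Y t) (k * dY t).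
    have := HY t (ltW t0) (ltW tT) => dYt.
    exact: (@is_deriveZ _ _ _ Y).
  rewrite -(@derive_val _ _ _ _ _ _ _ dk); apply: near_eq_derive.
  by near=> u; rewrite ZE// ltW//; near: u; exact: lt_nbhsl.
apply: ge0_ae_eq_integral_nonmeas => //.
- exact: measurable_int ci.
- by move=> t _; rewrite lee_fin mulr_ge0 ?sqr_ge0// ltW.
- by move=> t _; rewrite lee_fin addr_ge0// mulr_ge0 ?sqr_ge0// ltW.
- have h0 := ae_neq (0 : R); have hT := ae_neq T.
  apply: filterS2 h0 hT; first exact: (ae_filter_ringOfSetsType mu).
  move=> t tN0 tNT; rewrite /= in_itv/= => /andP[t0 tT].
  have {}t0 : 0 < t by rewrite lt_neqAle t0 andbT eq_sym; exact/eqP.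
  have {}tT : t < T by rewrite lt_neqAle tT andbT; exact/eqP.
  rewrite !dZ//; congr _%:E.
  have c1N : c1 != 0 by rewrite gt_eqF.
  have c2N : c2 != 0 by rewrite gt_eqF.
  have e : c * (c1^-1 + c2^-1) = 1.
    by rewrite /c /cpar mulVf// gt_eqF// addr_gt0// invr_gt0.
  transitivity (c * (c * (c1^-1 + c2^-1)) * dY t ^+ 2); last by rewrite e mulr1.
  by field; rewrite c1N c2N.
Unshelve. all: by end_near. Qed.

End lower_bound.

Section attainment.
Context (R : realType).
Notation mu := (@lebesgue_measure R).

Lemma cpath0 : cpath (cst 0 : R -> R).
Proof. by split => // t; exact: cvg_cst. Qed.

Lemma cost_rest (c1 c2 r y x : R) (h : R -> R) (ctl : (R -> R) * (R -> R)) :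
  cost c1 c2 r y h x 0 (cst 0, cst 0) ctl = (r * ctl.2 0)%:E.
Proof.
have ac0 : abs_continuous_on 0 0 (cst 0 : R -> R).
  move=> e e0; exists 1 => // n u v _ _ _.
  by rewrite big1// => i _; rewrite subrr normr0.
by rewrite /cost /energy asboolT// set_itv1 !integral_set1 sube0 add0e.
Qed.

Variables (c1 c2 r y b x : R) (h : R -> R).
Hypotheses (c10 : 0 < c1) (c20 : 0 < c2) (r0 : 0 < r) (b0 : 0 < b) (x0 : 0 <= x).
Notation c := (cpar c1 c2).
Hypothesis ch : {within `[0, b], continuous h}.
Hypotheses (h_ge0 : forall z, 0 <= z -> z <= b -> 0 <= h z).
Hypothesis h_nd : {in `[0, b] &, {homo h : u v / u <= v}}.
Hypothesis hr : forall z, 0 <= z -> z <= b -> r ^+ 2 / (4 * c) + r * y + h z <= 0.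
Variable alpha : (R -> R) * (R -> R) -> (R -> R) * (R -> R).
Hypothesis halpha : forall psi, cpath psi.1 -> cpath psi.2 ->
  exists phi, skorohod 0 b (free_path x y psi) phi (alpha psi).1 (alpha psi).2.

(* The optimal speed [s] may vanish at the barrier, hence the extra speed [d]. *)
Lemma barrier_cost_approx (d : R) : 0 < d -> 0 < x -> exists psi T,
  [/\ cpath psi.1, cpath psi.2, 0 <= T &
   ((gint c y h (Num.min x b) + r * (x - Num.min x b) - c * d * b)%:E <=
     cost c1 c2 r y h x T psi (alpha psi))%E].
Proof.
move=> d0 xgt0; have c0 : 0 < c by exact: cpar_gt0.
set xb := Num.min x b.
have xb0 : 0 < xb by rewrite lt_min xgt0.
have xbb : xb <= b by rewrite ge_min lexx orbT.
(* The flow asks for a speed continuous on the whole line, while [h] is controlled only on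
   [0, b]. *)
pose cl (z : R) := Num.min (Num.max z 0) b.
have clI z : 0 <= cl z <= b.
  by rewrite /cl le_min le_max lexx orbT (ltW b0)/= ge_min lexx orbT.
have clE z : 0 <= z -> z <= b -> cl z = z.
  by move=> z0 zb; rewrite /cl (max_l z0) (min_l zb).
have ccl : continuous cl.
  apply: min_fun_continuous; last by move=> z; exact: cvg_cst.
  by apply: max_fun_continuous; move=> z; [exact: cvg_id|exact: cvg_cst].
have chc : continuous (h \o cl).
  apply/continuous_subspace_setT.
  have cclT := (continuous_subspace_setT cl).1 ccl.
  apply: within_continuous_comp cclT ch.
  by move=> z _; rewrite /= in_itv/=.
(* Equality in Young's inequality with slope [k] requires psi1' - psi2' = k/(2c) = - y - s, so the
   free path moves with velocity - s. *)
pose s (z : R) := Num.sqrt (y ^+ 2 - h (cl z) / c).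
pose k (z : R) := hroot c y (h (cl z)).
pose v (z : R) := s z + d.
have cs : continuous s.
  move=> z; apply: continuous_comp; last exact: sqrt_continuous.
  apply: cvgB; first exact: cvg_cst.
  by apply: cvgM; [exact: chc|exact: cvg_cst].
have cv : continuous v by move=> z; apply: cvgD; [exact: cs|exact: cvg_cst].
have ck : continuous k.
  by move=> z; apply: cvgM; [exact: cvg_cst|apply: cvgB; [exact: cvg_cst|exact: cs]].
have sE z : s z ^+ 2 = y ^+ 2 - h (cl z) / c.
  have /andP[z0 zb] := clI z.
  by rewrite sqr_sqrtr// (discriminant_ge0 (r := r))//; exact: hr.
have s0 z : 0 <= s z by exact: sqrtr_ge0.
have sy z : s z <= `|y|.
  rewrite -sqrtr_sqr; apply: ler_wsqrtr; rewrite gerBl divr_ge0//; last exact: ltW.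
  by have /andP[z0 zb] := clI z; exact: h_ge0.
have vM z : d <= v z <= `|y| + d by rewrite /v lerDr s0 lerD2r sy.
have [X [T [T0 X0 XT HX]]] := decreasing_flow cv d0 vM xb0.
have XI t : 0 <= t -> t <= T -> 0 <= X t <= xb by move=> t0 tT; have [] := HX t t0 tT.
have dX t : 0 <= t -> t <= T -> is_derive t 1 X (- v (X t)).
  by move=> t0 tT; have [] := HX t t0 tT.
have cX : {within `[0, T], continuous X}.
  apply: derivable_within_continuous => t; rewrite in_itv/= => /andP[t0 tT].
  exact: (@ex_derive _ _ _ _ _ _ _) (dX t t0 tT).
have cvX : {within `[0, T], continuous (v \o X)}.
  exact: within_continuous_comp cX ((continuous_subspace_setT v).1 cv).
(* Start and drift are removed, so that the free path becomes x - xb + X; the excess x - xb is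
   pushed away by the initial jump. *)
pose Y t := X t - xb - y * t.
pose dY t := - v (X t) - y.
have HY t : 0 <= t -> t <= T -> is_derive t 1 Y (dY t).
  move=> t0 tT; have dXt := dX t t0 tT.
  rewrite /Y /dY; apply: is_derive_eq.
  by rewrite /GRing.scale/= subr0 mulr1.
have HdY t : 0 <= t -> t <= T -> `|dY t| <= `|y| + d + `|y|.
  move=> t0 tT; rewrite /dY -opprD normrN (le_trans (ler_normD _ _))// lerD2r.
  have /andP[h1 h2] := vM (X t); rewrite ger0_norm//.
  exact: le_trans (ltW d0) h1.
have cdY : {within `[0, T], continuous dY}.
  move=> t; apply: cvgB; last exact: cvg_cst.
  by apply: cvgN; exact: cvX.
have L0 : 0 < `|y| + d + `|y| by rewrite ltr_wpDr// ltr_wpDl.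
have Y0 : Y 0 = 0 by rewrite /Y X0 mulr0 subrr subr0.
have [psi [cp1 cp2 psiE eE]] := path_split c10 c20 T0 L0 Y0 HY HdY cdY.
exists psi, T; split => //; first exact: ltW.
have [phi sk] := halpha cp1 cp2.
have T0' := ltW T0.
have freeE t : 0 <= t -> t <= T -> free_path x y psi t = x - xb + X t.
  move=> t0 tT; rewrite /free_path; have := psiE t t0 tT; rewrite /Y; lra.
have Xlb t : 0 <= t -> t <= T -> X t <= b.
  by move=> t0 tT; have /andP[_ /le_trans] := XI t t0 tT; apply.
have [chp runE] := skorohod_running_cost b0 ch T cp1 cp2 sk.
rewrite /cost runE eE -!EFinD lee_fin.
have pushed := skorohod_pushed b0 T0' cp1 cp2 sk.
have above t : 0 <= t -> t <= T -> X t <= phi t.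
  exact: (skorohod_ge b0 x0 cp1 cp2 sk cX X0 Xlb freeE).
have [_ phib _ _ _] := sk.
have chX : {within `[0, T], continuous (h \o X)}.
  apply: (within_continuous_comp (B := `[0, b])) => //.
  move=> t; rewrite /= !in_itv/= => /andP[t0 tT].
  by rewrite Xlb// andbT; have /andP[] := XI t t0 tT.
have cdY2 : {within `[0, T], continuous (fun t => c * dY t ^+ 2)}.
  move=> t; apply: cvgM; first exact: cvg_cst.
  by rewrite expr2; apply: cvgM; exact: cdY.
have i1 := continuous_itv_integrable chp.
have i2 := continuous_itv_integrable chX.
have i3 := continuous_itv_integrable cdY2.
(* [k(X) v(X)] is the rate at which g(X) decreases. Subtracting [c d v(X)] covers the extra speed,
   with margin [c d s >= 0]; since [X] travels the distance [xb], the total loss is [c d xb]. *)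
pose f t := (k (X t) - c * d) * v (X t).
have cf : {within `[0, T], continuous f}.
  have ckX : {within `[0, T], continuous (k \o X)}.
    exact: within_continuous_comp cX ((continuous_subspace_setT k).1 ck).
  move=> t; apply: cvgM; last exact: cvX.
  by apply: cvgB; [exact: ckX|exact: cvg_cst].
have i4 := continuous_itv_integrable cf.
have le1 : \int[mu]_(t in `[0, T]) h (X t) <= \int[mu]_(t in `[0, T]) h (phi t).
  apply: le_Rintegral => // t; rewrite /= in_itv/= => /andP[t0 tT].
  have := phib t t0; rewrite in_itv/= => /andP[p0 pb].
  have /andP[Xt0 _] := XI t t0 tT.
  by apply: h_nd; rewrite ?in_itv/= ?p0 ?pb ?Xt0 ?Xlb ?above.
have le2 : \int[mu]_(t in `[0, T]) f t <=
    \int[mu]_(t in `[0, T]) h (X t) - \int[mu]_(t in `[0, T]) (c * dY t ^+ 2).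
  rewrite -RintegralB//; apply: le_Rintegral => //.
    have -> : EFin \o (fun t => h (X t) - c * dY t ^+ 2) =
        ((EFin \o (h \o X)) \- (EFin \o (fun t => (c * dY t ^+ 2)%R)))%E.
      by apply/funext => t /=; rewrite EFinB.
    exact: integrableB.
  move=> t; rewrite /= in_itv/= => /andP[t0 tT].
  have /andP[Xt0 _] := XI t t0 tT.
  rewrite /f /dY /k /hroot -/(s (X t)) /v -subr_ge0.
  have -> : h (X t) = c * (y ^+ 2 - s (X t) ^+ 2).
    by rewrite sE clE ?Xlb//; field; rewrite gt_eqF.
  rewrite [leRHS](_ : _ = c * d * s (X t)); last by ring.
  by rewrite mulr_ge0// mulr_ge0// ltW.
pose B (z : R) := \int[mu]_(u in `[-1, z]) k u.
have h1 : -1 < 0 :> R by rewrite oppr_lt0.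
have fE : \int[mu]_(t in `[0, T]) f t = B xb - B 0 - c * d * xb.
  have dF t : 0 <= t -> t <= T -> is_derive t 1 (fun t => c * d * X t - B (X t)) (f t).
    move=> t0 tT; have dXt := dX t t0 tT.
    have /andP[Xt0 _] := XI t t0 tT.
    have dBX : is_derive t 1 (B \o X) (k (X t) * - v (X t)).
      by apply: is_derive1_comp; apply: is_derive_primitive => //; exact: lt_le_trans Xt0.
    have -> : f t = c * d * - v (X t) - k (X t) * - v (X t) by rewrite /f; ring.
    by apply: is_deriveB; exact: (@is_deriveZ _ _ _ X).
  by rewrite (derive_itv_FTC T0 cf dF) X0 XT; ring.
have BE : B xb - B 0 = gint c y h xb.
  rewrite /B Rintegral_itvB ?bnd_simp//; [|exact: continuous_integrable|exact: ltW..].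
  rewrite Rintegral_itv_obnd_cbnd; last first.
    have := continuous_integrable 0 xb ck.
    by apply: integrableS => //; exact: subset_itv_oc_cc.
  apply: eq_Rintegral => z; rewrite inE/= in_itv/= => /andP[z0 zx].
  by rewrite /k clE// (le_trans zx).
have : c * d * xb <= c * d * b by rewrite ler_pM2l// mulr_gt0.
have : r * (x - xb) <= r * (alpha psi).2 T by rewrite ler_pM2l.
move: le1 le2; rewrite fE BE; lra.
Qed.

End attainment.

(** * Value of the barrier strategy *)

Unset Implicit Arguments.
Set Strict Implicit.

Theorem theorem3p4 (R : realType) (D r c1 c2 y : R) (h : R -> R)
    (hD : 0 < D) (hr : 0 < r) (hc1 : 0 < c1) (hc2 : 0 < c2)
    (h_cont : {within `[0, D], continuous h})
    (h_incr : {in `[0, D] &, {homo h : u v / u < v}})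
    (h0 : h 0 = 0)
    (hy : r / (4 * cpar c1 c2) <= - y)
    (x : R) (hx : x \in `[0, D])
    (alpha : (R -> R) * (R -> R) -> (R -> R) * (R -> R))
    (halpha : barrier_strategy y (beta0 D r (cpar c1 c2) y h) x alpha) :
  (g D r (cpar c1 c2) y h x)%:E = J c1 c2 r y h x alpha.
Proof.
have c0 : 0 < cpar c1 c2 by exact: cpar_gt0.
have [b0 bD hrb] := beta0_itv hD c0 hr h_cont h_incr h0 hy.
move: halpha; rewrite /g /barrier_strategy.
set b := beta0 D r (cpar c1 c2) y h in b0 bD hrb *; set c := cpar c1 c2 in c0 hy hrb *.
move: hx; rewrite in_itv/= => /andP[x0 xD].
have gint0 : gint c y h 0 = 0 by rewrite /gint set_itv1 Rintegral_set1.
have h_nd : {in `[0, D] &, {homo h : u v / u <= v}}.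
  move=> u v uI vI; rewrite le_eqVlt => /predU1P[->//|uv].
  by rewrite ltW// h_incr.
have h_nd' : {in `[0, b] &, {homo h : u v / u <= v}}.
  move=> u v; rewrite !in_itv/= => /andP[u0 ub] /andP[v0 vb].
  by apply: h_nd; rewrite in_itv/= ?u0 ?v0 (le_trans _ bD).
have h_ge0 z : 0 <= z -> z <= b -> 0 <= h z.
  by move=> z0 zb; rewrite -h0; apply: h_nd' => //; rewrite in_itv/= ?lexx ?z0.
have hrz z : 0 <= z -> z <= b -> r ^+ 2 / (4 * c) + r * y + h z <= 0.
  move=> z0 zb; apply: le_trans hrb; rewrite lerD2l.
  by apply: h_nd' => //; rewrite in_itv/= ?z0 ?b0 ?lexx.
have h_cont' : {within `[0, b], continuous h}.
  by apply: continuous_subspaceW h_cont; apply: subset_itvl; rewrite bnd_simp.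
have rest : (J c1 c2 r y h x alpha >= (r * (alpha (cst 0, cst 0)).2 0)%:E)%E.
  apply: ereal_sup_ubound; exists (cst 0, cst 0), 0; split => //; try exact: cpath0.
  by rewrite cost_rest.
have [bE|bN] := eqVneq b 0 => halpha.
  have -> : (if x <= b then gint c y h x else gint c y h b + r * (x - b)) = r * x.
    rewrite bE; case: ifPn => [xle|_]; last by rewrite gint0 add0r subr0.
    have -> : x = 0 by apply/eqP; rewrite eq_le xle x0.
    by rewrite gint0 mulr0.
  apply/eqP; rewrite eq_le; apply/andP; split.
    have cst_ac : abs_continuous_on 0 0 (cst 0 : R -> R).
      by apply: (lipschitz_abs_continuous ltr01) => u v _ uv _; rewrite subrr normr0 mul1r subr_ge0.
    have [|_] := halpha (cst 0, cst 0) (cpath0 _) (cpath0 _) 0 (lexx _) cst_ac cst_ac 0.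
      by rewrite in_itv/= lexx.
    by rewrite set_itv1 Rintegral_set1 addr0 => e; rewrite e in rest.
  apply: ge_ereal_sup => _ [psi [T [cp1 cp2 T0 ->]]].
  apply: zero_barrier_cost_le => //.
    by have := hrz 0 (lexx _) b0; rewrite h0 addr0.
  exact: (halpha psi cp1 cp2 T T0).
have {bN}b0' : 0 < b by rewrite lt_neqAle eq_sym bN.
apply/eqP; rewrite eq_le; apply/andP; split; last first.
  apply: ge_ereal_sup => _ [psi [T [cp1 cp2 T0 ->]]].
  have [phi sk] := halpha psi cp1 cp2.
  exact: (barrier_cost_le hc1 hc2 hr b0' x0 hy h_cont' h_ge0 h0 hrz T0 cp1 cp2 sk).
(* The descending path needs a positive start; at x = 0 both g(0) = 0 and the game stopped at once
   suffice. *)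
move: x0; rewrite le_eqVlt => /predU1P[xE|x0].
  have -> : (if x <= b then gint c y h x else gint c y h b + r * (x - b)) = 0.
    by rewrite -xE b0 gint0.
  rewrite (le_trans _ rest)// lee_fin; apply: mulr_ge0; first exact: ltW.
  have [phi [_ _ [_ [_ _ p0]] _ _]] := halpha (cst 0, cst 0) (cpath0 _) (cpath0 _).
  exact: p0.
apply/lee_addgt0Pr => e e0.
(* This extra speed makes the loss [c * d * b] equal to [e]. *)
have d0 : 0 < e / (c * b) by rewrite divr_gt0// mulr_gt0.
have [psi [T [cp1 cp2 T0 le_cost]]] := barrier_cost_approx hc1 hc2 hr b0' (ltW x0)
  h_cont' h_ge0 h_nd' hrz halpha d0 x0.
rewrite -leeBlDr//; apply: le_trans (ereal_sup_ubound _); last first.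
  by exists psi, T; split.
apply: le_trans le_cost; rewrite -EFinB lee_fin.
have -> : c * (e / (c * b)) * b = e by field; rewrite !gt_eqF.
rewrite lerD2r; case: (leP x b) => [xb|bx].
  by rewrite subrr mulr0 addr0.
by [].
Qed.
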